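(* Let $\Omega\subset\mathbb{R}^n$ be a bounded open Lipschitz domain, $\alpha\in(0,1)$, $T>0$, and let $g\in\mathbb{R}$ be a constant boundary value. Let $P=\Omega\times(0,T]$ and $\Gamma=\partial\Omega\times(0,T)\,\cup\,\Omega\times\{t=0\}$. Let $k:P\to\mathbb{R}$ be a bounded continuous function with $k(x,t)\ge k_0>0$ for all $(x,t)\in P$ and some constant $k_0$. Suppose $u\in C^{1,1}(P)\cap C(\overline P)$ with $u-g\in C([0,T],\mathbb{H}^{2\alpha}(\Omega))$ satisfies the differential inequality $$k(x,t)\,\partial_t u+(-\Delta_g)^\alpha u+c(u)\,u\ge0\quad\text{in }P,$$ and $\min_\Gamma u(x,t)\ge0$, where $c:\mathbb{R}\to\mathbb{R}$ satisfies $c(u)\ge-c_0$ with a constant $c_0>0$. Then $\min_{\overline P}u(x,t)\ge0$.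
   Context: $C^{1,1}(P)$ denotes the set of functions on $P$ that are continuously differentiable with respect to $x$ and continuously differentiable with respect to $t$. Let $\{(\lambda_k,\varphi_k)\}_{k\ge1}$ be the Dirichlet eigenpairs of $-\Delta$ on $\Omega$, with $\{\varphi_k\}$ an orthonormal basis of $L^2(\Omega)$, and $u_k=\int_\Omega u\varphi_k\,dx$. The spectral fractional Laplacian is $(-\Delta)^\alpha u=\sum_k\lambda_k^\alpha u_k\varphi_k$, with domain $\mathbb{H}^{2\alpha}(\Omega)=\{u\in L^2(\Omega):\sum_k\lambda_k^{2\alpha}|u_k|^2<\infty\}$ normed by $(\sum_k\lambda_k^{2\alpha}|u_k|^2)^{1/2}$. The inhomogeneous spectral fractional Laplacian associated with the boundary condition $u|_{\partial\Omega}=g$ ($g$ constant) is $(-\Delta_g)^\alpha u:=(-\Delta)^\alpha(u-g)$, defined for $u$ with $u-g\in\mathbb{H}^{2\alpha}(\Omega)$.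
   Formalization: The boundary condition u = g on ∂Ω×(0,T) is an explicit hypothesis; without it the claim fails for α<1/4 (g very negative, u = −tψ with ψ≥0 a nonzero test function, k=1, c=0). *)

(* Defs.v *)
From HB Require Import structures.
From mathcomp Require Import all_boot all_order all_algebra.
From mathcomp Require Import all_classical all_reals all_analysis.
Set Implicit Arguments.
Unset Strict Implicit.
Unset Printing Implicit Defensive.
Import Order.TTheory GRing.Theory Num.Theory.
Import numFieldNormedType.Exports.
Local Open Scope classical_set_scope.
Local Open Scope ring_scope.

(* Row vectors carry the product sigma-algebra, which on R^n is the Borel one.
   Every class of L^2 has a Borel representative, so working with Borel
   functions modulo negligible sets loses nothing. *)
Section measurable_rV.
Context {d} {T : sigmaRingType d}.
Variable n : nat.

Let coors : 'I_n -> 'rV[T]_n -> T := fun i x => x ord0 i.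

Let rV_set0 : g_sigma_preimage coors set0.
Proof. exact: sigma_algebra0. Qed.

Let rV_setC A : g_sigma_preimage coors A -> g_sigma_preimage coors (~` A).
Proof. exact: sigma_algebraC. Qed.

Let rV_bigcup (F : _^nat) : (forall i, g_sigma_preimage coors (F i)) ->
  g_sigma_preimage coors (\bigcup_i (F i)).
Proof. exact: sigma_algebra_bigcup. Qed.

HB.instance Definition _ := @isMeasurable.Build (measure_tuple_display d)
  'rV[T]_n (g_sigma_preimage coors) rV_set0 rV_setC rV_bigcup.

End measurable_rV.

Lemma measurable_coord d (T : sigmaRingType d) n (i : 'I_n) :
  measurable_fun [set: 'rV[T]_n] (fun x : 'rV[T]_n => x ord0 i).
Proof.
move=> _ Y mY; rewrite setTI; apply: sub_sigma_algebra => /=.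
rewrite -bigcup_seq/=; exists i => /=; first by rewrite mem_index_enum.
by exists Y => //; rewrite setTI.
Qed.

Lemma measurable_fun_coord d1 d2 (T1 : measurableType d1)
    (T2 : measurableType d2) n (f : T1 -> 'rV[T2]_n) :
  (forall i, measurable_fun [set: T1] (fun x => f x ord0 i)) ->
  measurable_fun [set: T1] f.
Proof.
move=> mf _ A mA; rewrite setTI; move: A mA.
have sA : sigma_algebra setT [set A | measurable (f @^-1` A)].
  split => /=; first by rewrite preimage_set0.
  - by move=> A mA; rewrite setTD preimage_setC; exact: measurableC.
  - by move=> F mF; rewrite preimage_bigcup; exact: bigcup_measurable.
apply: smallest_sub => //.
rewrite -bigcup_seq; apply: bigcup_sub => i _ A [B mB <-] /=.
rewrite setTI -[X in measurable X]setTI; exact: (mf i).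
Qed.

Section lebesgue_rV.
Variable R : realType.

Definition rV_cons n (p : measurableTypeR R * 'rV[R]_n) : 'rV[R]_n.+1 :=
  \row_i oapp (p.2 ord0) p.1 (unlift ord0 i).

Definition rV_uncons n (x : 'rV[R]_n.+1) : measurableTypeR R * 'rV[R]_n :=
  (x ord0 ord0, \row_i x ord0 (lift ord0 i)).

Lemma rV_consK n : cancel (@rV_cons n) (@rV_uncons n).
Proof.
move=> [a v]; rewrite /rV_uncons /rV_cons !mxE unlift_none /=; congr pair.
by apply/rowP => i; rewrite !mxE liftK.
Qed.

Lemma rV_unconsK n : cancel (@rV_uncons n) (@rV_cons n).
Proof.
move=> x; apply/rowP => i; rewrite !mxE.
by case: unliftP => [j|] -> //=; rewrite mxE.
Qed.

Lemma measurable_rV_cons n : measurable_fun setT (@rV_cons n).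
Proof.
apply: measurable_fun_coord => i.
under eq_fun do rewrite mxE.
case: unliftP => [j|] _ /=; last exact: measurable_fst.
by apply: (measurableT_comp (measurable_coord j)); exact: measurable_snd.
Qed.

Lemma measurable_rV_uncons n : measurable_fun setT (@rV_uncons n).
Proof.
apply: measurable_fun_pair; first exact: measurable_coord.
apply: measurable_fun_coord => i.
by under eq_fun do rewrite mxE; exact: measurable_coord.
Qed.

Section step.
Variable n : nat.
Variable m : {sigma_finite_measure set 'rV[R]_n -> \bar R}.

Definition leb_step : set 'rV[R]_n.+1 -> \bar R :=
  fun A => (lebesgue_measure \x m)%E (@rV_cons n @^-1` A).

Let leb_step0 : leb_step set0 = 0%E.
Proof. by rewrite /leb_step preimage_set0 measure0. Qed.

Let leb_step_ge0 A : (0 <= leb_step A)%E.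
Proof. exact: measure_ge0. Qed.

Let leb_step_sigma_additive : semi_sigma_additive leb_step.
Proof.
have mc A : measurable A -> measurable (@rV_cons n @^-1` A).
  by move=> mA; rewrite -[X in measurable X]setTI; exact: measurable_rV_cons.
move=> F mF tF mUF; rewrite /leb_step preimage_bigcup.
apply: measure_semi_sigma_additive.
- by move=> k; exact: mc.
- apply/trivIsetP => /= i j _ _ ij; rewrite -preimage_setI.
  by move/trivIsetP : tF => /(_ _ _ _ _ ij) ->//; rewrite preimage_set0.
- by rewrite -preimage_bigcup; exact: mc.
Qed.

HB.instance Definition _ := isMeasure.Build _ _ _ leb_step
  leb_step0 leb_step_ge0 leb_step_sigma_additive.

Let leb_step_sigma_finite : sigma_finite setT leb_step.
Proof.
have /sigma_finiteP[F [TF ndF Foo]] := sigma_finiteT (@lebesgue_measure R).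
have /sigma_finiteP[G [TG ndG Goo]] := sigma_finiteT m.
exists (fun k => @rV_uncons n @^-1` (F k `*` G k)).
  rewrite -preimage_bigcup (_ : \bigcup_k _ = setT) ?preimage_setT//.
  rewrite -setXTT TF TG predeqE => -[x y].
  split; first by move=> [k _ []/= ? ?]; split; exists k.
  move=> [/= [k _ Fkx] [l _ Gly]]; exists (maxn k l) => //; split.
  - by move: x Fkx; exact/subsetPset/ndF/leq_maxl.
  - by move: y Gly; exact/subsetPset/ndG/leq_maxr.
move=> k; have [? ?] := Foo k; have [? ?] := Goo k.
have mFG : measurable (F k `*` G k) by exact: measurableX.
split; first by rewrite -[X in measurable X]setTI; exact: measurable_rV_uncons.
rewrite /leb_step -comp_preimage (_ : _ \o _ = id) ?preimage_id; last first.
  by apply/funext => x /=; rewrite rV_consK.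
by rewrite product_measure1E// lte_mul_pinfty// ge0_fin_numE.
Qed.

HB.instance Definition _ :=
  Measure_isSigmaFinite.Build _ _ _ leb_step leb_step_sigma_finite.

End step.

Fixpoint leb n : {sigma_finite_measure set 'rV[R]_n -> \bar R} :=
  match n with
  | 0%N => @dirac _ 'rV[R]_0 0 R
  | n'.+1 => leb_step (leb n')
  end.

(* The measure of a box is the product of the measures of its sides; this
   characterizes Lebesgue measure. *)
Lemma leb_box n (A : 'I_n -> set (measurableTypeR R)) :
  (forall i, measurable (A i)) ->
  leb n [set x | forall i, A i (x ord0 i)] =
  (\prod_(i < n) (lebesgue_measure (A i)))%E.
Proof.
elim: n A => [|n IHn] A mA.
  by rewrite big_ord0 /= diracE mem_set//= => -[].
set B := [set x : 'rV[R]_n | forall i, A (lift ord0 i) (x ord0 i)].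
have mB : measurable B.
  rewrite (_ : B = \bigcap_(i in [set: 'I_n])
      ((fun x : 'rV[R]_n => x ord0 i) @^-1` A (lift ord0 i))); last first.
    by apply/seteqP; split => [x Ax i _|x Ax i]; [exact: Ax|exact: (Ax i)].
  apply: fin_bigcap_measurable => // i _.
  rewrite -[X in measurable X]setTI.
  by apply: measurable_coord => //; exact: mA.
rewrite big_ord_recl -(IHn (fun i => A (lift ord0 i))) => [|i]; last exact: mA.
rewrite -/B -(product_measure1E _ _ (mA ord0) mB).
suff E : @rV_cons n @^-1` [set x | forall i, A i (x ord0 i)] = A ord0 `*` B.
  by rewrite /= /leb_step E.
apply/seteqP; split => [[a v] /= Av|[a v] /= [Aa Av] i].
  split => [|i].
    by have := Av ord0; rewrite !mxE unlift_none.
  by have := Av (lift ord0 i); rewrite !mxE liftK.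
by rewrite !mxE; case: unliftP => [j|] ->.
Qed.

End lebesgue_rV.

Section domains.
Variable R : realType.

Definition bdry (T : topologicalType) (A : set T) : set T :=
  closure A `\` interior A.

(* Near each boundary point, after a change of orthonormal frame, the set lies
   strictly above the graph of a Lipschitz function of the remaining
   coordinates.  The norm on row vectors is the sup norm, which changes neither
   the topology nor the class of Lipschitz functions. *)
Definition lipschitz_boundary n (Om : set 'rV[R]_n.+1) : Prop :=
  forall x0, bdry Om x0 ->
  exists (r : R) (Q : 'M[R]_n.+1) (gam : 'rV[R]_n -> R),
    [/\ 0 < r, Q *m Q^T = 1%:M, lipschitz gam &
        forall x, ball x0 r x ->
          Om x <-> gam (col' ord0 (x *m Q)) < (x *m Q) ord0 ord0].

Definition bounded_lipschitz_domain n (Om : set 'rV[R]_n.+1) : Prop :=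
  [/\ open Om, connected Om, Om !=set0, bounded_set Om & lipschitz_boundary Om].

Variable n : nat.
Implicit Types (Om : set 'rV[R]_n) (T : R) (u : 'rV[R]_n * R -> R).

Definition cylinder Om T : set ('rV[R]_n * R) := Om `*` `]0, T].

Definition parabolic_boundary Om T : set ('rV[R]_n * R) :=
  (bdry Om `*` `]0, T[) `|` (Om `*` [set 0]).

Definition ebasis (i : 'I_n) : 'rV[R]_n := delta_mx ord0 i.

(* Only times in ]0, T] enter the difference quotient, so this is the left
   derivative at t = T. *)
Definition time_quotient T u (z : 'rV[R]_n * R) : set_system R :=
  (u (z.1, s) - u z) / (s - z.2) @[s --> within `]0, T] (z.2)^'].

Definition dt T u (z : 'rV[R]_n * R) : R := lim (time_quotient T u z).

Definition dx i u (z : 'rV[R]_n * R) : R :=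
  'D_(ebasis i) (fun y => u (y, z.2)) z.1.

Definition C11 Om T u : Prop :=
  [/\ forall i z, cylinder Om T z -> derivable (fun y => u (y, z.2)) z.1 (ebasis i),
      forall i, {within cylinder Om T, continuous (dx i u)},
      forall z, cylinder Om T z -> cvg (time_quotient T u z) &
      {within cylinder Om T, continuous (dt T u)}].

End domains.

Section sobolev.
Variables (R : realType) (n : nat) (Om : set 'rV[R]_n).
Implicit Types (f v w psi : 'rV[R]_n -> R) (G : 'I_n -> 'rV[R]_n -> R).

Definition inL2 f : Prop :=
  measurable_fun Om f /\ (\int[leb R n]_(x in Om) ((f x) ^+ 2)%:E < +oo)%E.

Definition dotL2 f v : R := \int[leb R n]_(x in Om) (f x * v x).

(* The extended-real integral, not its real-valued truncation: a difference
   that is not square integrable must not count as small. *)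
Definition cvgL2 (f_ : nat -> 'rV[R]_n -> R) f : Prop :=
  (\int[leb R n]_(x in Om) ((f_ j x - f x) ^+ 2)%:E)%E @[j --> \oo] --> 0%E.

Definition partial i f : 'rV[R]_n -> R := fun x => 'D_(ebasis R i) f x.

Definition smooth f : Prop :=
  forall s : seq 'I_n, let h := foldr partial f s in
    continuous h /\ forall i x, derivable h x (ebasis R i).

Definition test_function psi : Prop :=
  smooth psi /\
  exists K, [/\ compact K, K `<=` Om & forall x, ~ K x -> psi x = 0].

(* w belongs to H^1 with weak gradient G. *)
Definition inH1 w G : Prop :=
  [/\ inL2 w, forall i, inL2 (G i) &
      forall psi i, test_function psi ->
        dotL2 w (partial i psi) = - dotL2 (G i) psi].

(* H^1_0 is the closure of the test functions in H^1. *)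
Definition inH10 w G : Prop :=
  inH1 w G /\
  exists psi_ : nat -> 'rV[R]_n -> R,
    [/\ forall j, test_function (psi_ j), cvgL2 psi_ w &
        forall i, cvgL2 (fun j => partial i (psi_ j)) (G i)].

(* Weak formulation of - Delta phi = l phi in Om, phi = 0 on the boundary. *)
Definition dirichlet_eigenpair (l : R) phi : Prop :=
  dotL2 phi phi != 0 /\
  exists2 G, inH10 phi G &
    forall v H, inH10 v H ->
      \sum_(i < n) dotL2 (G i) (H i) = l * dotL2 phi v.

Definition orthonormal_basis (phi : nat -> 'rV[R]_n -> R) : Prop :=
  [/\ forall k, inL2 (phi k),
      forall j k, dotL2 (phi j) (phi k) = (j == k)%:R &
      forall f, inL2 f ->
        cvgL2 (fun N x => \sum_(k < N) dotL2 f (phi k) * phi k x) f].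

Definition dirichlet_eigenbasis (lam : nat -> R) (phi : nat -> 'rV[R]_n -> R) :
    Prop :=
  orthonormal_basis phi /\ forall k, dirichlet_eigenpair (lam k) (phi k).

End sobolev.

Section fractional.
Variables (R : realType) (n : nat) (Om : set 'rV[R]_n).
Variables (lam : nat -> R) (phi : nat -> 'rV[R]_n -> R) (alpha : R).
Implicit Types f v : 'rV[R]_n -> R.

(* The squared norm of H^{2 alpha}, as an extended real. *)
Definition sqnormH v : \bar R :=
  (\sum_(0 <= k <oo) (lam k `^ (2 * alpha) * (dotL2 Om v (phi k)) ^+ 2)%:E)%E.

Definition inH v : Prop := inL2 Om v /\ (sqnormH v < +oo)%E.

Definition normH v : R := Num.sqrt (fine (sqnormH v)).

(* f is (a representative of) (- Delta)^alpha v, the series converging in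
   L^2. *)
Definition is_fracLap v f : Prop :=
  inL2 Om f /\
  cvgL2 Om
    (fun N x => \sum_(k < N) lam k `^ alpha * dotL2 Om v (phi k) * phi k x) f.

Definition is_fracLap_bc (g : R) v f : Prop :=
  is_fracLap (fun x => v x - g) f.

Definition continuous_inH (T : R) (v : 'rV[R]_n * R -> R) : Prop :=
  forall t, t \in `[0, T] ->
    inH (fun x => v (x, t)) /\
    normH (fun x => v (x, s) - v (x, t)) @[s --> within `[0, T] (nbhs t)] --> 0.

End fractional.

(* Main.v *)
Require Import Defs.
From mathcomp Require Import all_boot all_order all_algebra.
From mathcomp Require Import all_classical all_reals all_analysis.
From mathcomp Require Import measurable_realfun ring lra.
Set Implicit Arguments.
Unset Strict Implicit.
Unset Printing Implicit Defensive.
Import Order.TTheory GRing.Theory Num.Theory.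
Import numFieldNormedType.Exports.
Local Open Scope classical_set_scope.
Local Open Scope ring_scope.

(** Let L = 4 c0 / k0 and suppose that exp (- L t) u has a negative minimum over
    the closed cylinder, attained at (x0, t0).  The sign of u on the parabolic
    boundary, extended by continuity, forces x0 in Om and t0 > 0.  Let m be the
    value of u there.  Minimality in time gives dt u <= (3 / 4) L m at every
    minimum point at time t0 (dt_le_of_exp_min), so by continuity and
    compactness there is a level lev with m < lev < 0 such that
    dt u < (1 / 2) L m wherever u (., t0) < lev.  On that set the
    differential inequality yields f >= - c0 m > 0 almost everywhere, where f is
    the fractional Laplacian of v = u (., t0) - g.  With
    w = max (lev - u (., t0)) 0, the pairing <f, w> is therefore positive.

    The fractional Laplacian being known through its spectral expansion in L^2,
    f has no value at x0 and the classical evaluation at a minimum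
    is replaced by a weak maximum principle (fracLap_trunc_le0): for l <= 0,
    <A ^ alpha v, max (l - v) 0> <= 0, with A the Dirichlet Laplacian.  It
    applies with l = lev - g, because g >= 0: a bounded open set has boundary
    points, and u = g >= 0 there.

    This principle is first proved for A (A + mu)^-1 in place of A ^ alpha
    (yosida_pairing_le), by the argument of Beurling and Deny: the resolvent
    mu (mu + A)^-1 is a self-adjoint contraction, and it preserves the lower
    bound l, as one sees by testing the weak equation with a truncation
    (resolvent_lower_bound).  The truncation is approximated by a smooth function
    of test functions, so that all that is needed of H^1_0 is that test
    functions belong to it (test_inH10, an integration by parts).  Then
    lambda ^ alpha is written as a positive mixture of the functions
    lambda / (lambda + mu) (subordination). *)

(** * Borel sets and Lebesgue measure on row vectors *)

Section euclidean_measure.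
Variable R : realType.

Lemma rV_ballP n (x y : 'rV[R]_n) (e : R) : 0 < e ->
  ball x e y <-> forall i, `|x ord0 i - y ord0 i| < e.
Proof.
move=> e0; split => [[_ xy] i|xy]; first exact: xy.
by split => // i j; rewrite (ord1 i); exact: xy.
Qed.

Lemma measurable_rV_box n (A : 'I_n -> set R) :
  (forall i, measurable (A i)) ->
  measurable [set x : 'rV[R]_n | forall i, A i (x ord0 i)].
Proof.
move=> mA.
rewrite (_ : mkset _ = \bigcap_(i in [set: 'I_n])
      ((fun x : 'rV[R]_n => x ord0 i) @^-1` A i)); last first.
  by apply/seteqP; split => [x Ax i _|x Ax i]; [exact: Ax|exact: (Ax i)].
apply: fin_bigcap_measurable => // i _.
rewrite -[X in measurable X]setTI.
by apply: measurable_coord => //; exact: mA.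
Qed.

Lemma rV_ball_box n (x : 'rV[R]_n) e : 0 < e ->
  ball x e = [set y | forall i, (`]x ord0 i - e, x ord0 i + e[%classic : set R) (y ord0 i)].
Proof.
move=> e0; apply/seteqP; split => y.
  by move/(rV_ballP _ _ e0) => h i /=; rewrite in_itv/= -ltr_distlC; exact: h.
move=> h; apply/(rV_ballP _ _ e0) => i; have := h i.
by rewrite /= in_itv/= -ltr_distlC.
Qed.

Lemma measurable_rV_ball n (x : 'rV[R]_n) e : measurable (ball x e).
Proof.
have [e0|e0] := ltP 0 e; last first.
  rewrite (_ : ball x e = set0)//; apply/seteqP; split => // y [] /lt_le_trans.
  by move=> /(_ _ e0); rewrite ltxx.
rewrite rV_ball_box//.
apply: (measurable_rV_box
  (A := fun i => `]x ord0 i - e, x ord0 i + e[%classic)) => i.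
exact: measurable_itv.
Qed.

(** A ball for the sup norm is a box, and an open set is the countable union of
    the balls it contains that have a rational centre and radius 1 / (m + 1). *)
Lemma open_measurable_rV n (U : set 'rV[R]_n) : open U -> measurable U.
Proof.
move=> oU.
pose B (p : 'rV[rat]_n * nat) : set 'rV[R]_n :=
  ball (map_mx ratr p.1 : 'rV[R]_n) (p.2.+1%:R^-1 : R).
have -> : U = \bigcup_(p in [set p | B p `<=` U]) B p.
  apply/seteqP; split => [x Ux|x [p pU] /pU//].
  have [e e0 xeU] : exists2 e, 0 < e & ball x e `<=` U.
    by move/nbhs_ballP : (open_nbhs_nbhs (conj oU Ux)) => [e e0 h]; exists e.
  have [m me] : exists m : nat, (m.+1%:R^-1 : R) < e / 2.
    have e20 : 0 < e / 2 by rewrite divr_gt0.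
    by have := near_infty_natSinv_lt (PosNum e20); case=> m _ h; exists m; have := h m (leqnn m).
  have m0 : 0 < m.+1%:R^-1 :> R by rewrite invr_gt0.
  have /choice[q qx] : forall i, exists q : rat, `|ratr q - x ord0 i| < m.+1%:R^-1.
    move=> i; have := @dense_rat R (ball (x ord0 i) m.+1%:R^-1).
    case; first by exists (x ord0 i); exact: ballxx.
      exact: ball_open.
    by move=> y [xy [q _ qy]]; exists q; rewrite qy distrC.
  exists (\row_i q i, m).
    move=> y /= /(rV_ballP _ _ m0) h; apply: xeU; apply/rV_ballP => // i.
    have := h i; rewrite !mxE => hi.
    have -> : x ord0 i - y ord0 i = (x ord0 i - ratr (q i)) + (ratr (q i) - y ord0 i).
      by ring.
    rewrite (le_lt_trans (ler_normD _ _))//.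
    rewrite [ltRHS]splitr ltrD//; last exact: lt_trans me.
    by rewrite distrC; apply: lt_trans me; exact: qx.
  by apply/rV_ballP => // i; rewrite !mxE.
rewrite bigcup_mkcond; apply: countable_bigcupT_measurable.
  exact: countableP.
by move=> p; case: ifPn => // _; exact: measurable_rV_ball.
Qed.

Lemma continuous_measurable_rV n (f : 'rV[R]_n -> R) :
  continuous f -> measurable_fun setT f.
Proof.
move=> cf; apply: (measurability _ (RGenOpens.measurableE R)).
move=> _ [_ [a [b ->]] <-]; rewrite setTI; apply: open_measurable_rV.
by apply: open_comp => [x _|]; [exact: cf|exact: interval_open].
Qed.

Lemma leb_ball_gt0 n (x : 'rV[R]_n) e : 0 < e -> (0 < leb R n (ball x e))%E.
Proof.
move=> e0; rewrite rV_ball_box// (leb_box (A := fun i => `]x ord0 i - e, x ord0 i + e[%classic)) //.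
elim/big_ind : _ => // [a b|i _]; first exact: mule_gt0.
rewrite lebesgue_measure_itv/= lte_fin ifT; last by rewrite ltrD2l gtrN.
by rewrite -EFinD lte_fin; lra.
Qed.

Lemma leb_bounded_lty n (A : set 'rV[R]_n) :
  measurable A -> bounded_set A -> (leb R n A < +oo)%E.
Proof.
move=> mA [M [_ hM]].
have [K K0 AK] : exists2 K : R, 0 < K & A `<=` ball 0 K.
  exists (`|M| + 2) => [|x Ax]; first by rewrite ltr_pwDr.
  have := hM (`|M| + 1); rewrite (le_lt_trans (ler_norm _)) ?ltrDl//.
  move=> /(_ isT x Ax) => h.
  rewrite mx_norm_ball /ball_ /= sub0r normrN; apply: le_lt_trans h _.
  by rewrite ltrD2l ltr1n.
apply: (@le_lt_trans _ _ (leb R n (ball (0 : 'rV[R]_n) K))).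
  by apply: le_measure => //; rewrite inE//; exact: measurable_rV_ball.
rewrite rV_ball_box// (leb_box (A := fun i =>
  `](0 : 'rV[R]_n) ord0 i - K, (0 : 'rV[R]_n) ord0 i + K[%classic)) //.
rewrite ltey_eq prode_fin_num// => i _.
by rewrite lebesgue_measure_itv/=; case: ifP.
Qed.

End euclidean_measure.

(** * Integrals of partial derivatives *)

Section integral_partial.
Variable R : realType.
Notation mu := (@lebesgue_measure R).

Lemma integrable_finite_support d (T : measurableType d)
    (m : {measure set T -> \bar R}) (f : T -> R) (B : set T) (C : R) :
  measurable B -> (m B < +oo)%E -> measurable_fun setT f ->
  (forall x, `|f x| <= C) -> (forall x, ~ B x -> f x = 0) ->
  m.-integrable setT (EFin \o f).
Proof.
move=> mB Bfin mf fC f0.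
rewrite (_ : EFin \o f = (EFin \o f) \_ B); last first.
  apply/funext => x; rewrite patchE; case: ifPn => //.
  by rewrite notin_setE => /f0 /= ->.
rewrite -integrable_mkcond//; apply: measurable_bounded_integrable => //.
  exact: measurable_funS mf.
exists C; split; first exact: num_real.
by move=> M CM x _ /=; rewrite (le_trans (fC x))// ltW.
Qed.

Lemma integral_leb_cons n (f : 'rV[R]_n.+1 -> \bar R) :
  measurable_fun setT f ->
  (mu \x leb R n)%E.-integrable setT (f \o @rV_cons R n) ->
  (\int[leb R n.+1]_x f x = \int[mu \x leb R n]_z f (rV_cons z))%E.
Proof.
move=> mf intf.
have := integral_pushforward (@measurable_rV_cons R n) mf intf measurableT.
rewrite preimage_setT => <-; apply: eq_measure_integral => //.
exact: measurable_rV_cons.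
Qed.

Lemma rV_cons_shift0 n (h a : R) (v : 'rV[R]_n) :
  rV_cons (h + a, v) = h *: ebasis R ord0 + rV_cons (a, v).
Proof.
apply/rowP => j; rewrite !mxE; case: unliftP => [k ->|->] /=.
  by rewrite mulr0 add0r.
by rewrite mulr1.
Qed.

Lemma rV_cons_shift_lift n (h a : R) (v : 'rV[R]_n) (i : 'I_n) :
  rV_cons (a, h *: ebasis R i + v) = h *: ebasis R (lift ord0 i) + rV_cons (a, v).
Proof.
apply/rowP => j; rewrite !mxE; case: unliftP => [k ->|->] /=.
  by rewrite !mxE eqxx (inj_eq lift_inj).
by rewrite mulr0 add0r.
Qed.

Lemma integral_derive_compact (G g : R -> R) (K : R) : 0 < K ->
  (forall x : R, is_derive x 1 G (g x)) -> continuous g ->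
  (forall x, K <= `|x| -> G x = 0) -> (forall x, K <= `|x| -> g x = 0) ->
  (\int[mu]_x (g x)%:E = 0)%E.
Proof.
move=> K0 dG cg G0 g0.
have -> : (\int[mu]_x (g x)%:E = \int[mu]_(x in `[(- K)%R, K]) (g x)%:E)%E.
  rewrite [RHS]integral_mkcond; apply: eq_integral => x _.
  rewrite patchE; case: ifPn => //; rewrite notin_setE /= in_itv/= => /negP.
  by rewrite -ler_norml -ltNge => /ltW/g0 ->.
have dc x : {for x, continuous G}.
  by apply/differentiable_continuous/derivable1_diffP; exact: ex_derive.
have GK : G K = 0 by apply: G0; exact: ler_norm.
have GNK : G (- K) = 0 by apply: G0; rewrite normrN; exact: ler_norm.
have KK : - K < K by lra.
rewrite (@continuous_FTC2 _ g G _ _ KK) ?GK ?GNK ?subee//.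
- by apply: continuous_subspaceT.
- split => [x _||]; first exact: ex_derive.
  + by apply: cvg_at_right_filter; exact: dc.
  + by apply: cvg_at_left_filter; exact: dc.
- by move=> x _; rewrite derive1E; exact: derive_val.
Qed.

Lemma rV_cons_continuousr n a : continuous (fun v : 'rV[R]_n => rV_cons (a, v)).
Proof.
move=> v A /nbhs_ballP[e /= e0 eA]; apply/nbhs_ballP; exists e => //= w.
move=> /(rV_ballP _ _ e0) h; apply: eA; apply/(rV_ballP _ _ e0) => i.
by rewrite !mxE; case: unliftP => [k _|_] /=; rewrite ?subrr ?normr0.
Qed.

Lemma rV_cons_continuousl n v : continuous (fun a : R => @rV_cons R n (a, v)).
Proof.
move=> a A /nbhs_ballP[e /= e0 eA]; apply/nbhs_ballP; exists e => //= b h.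
apply: eA; apply/(rV_ballP _ _ e0) => i.
by rewrite !mxE; case: unliftP => [k _|_] /=; rewrite ?subrr ?normr0.
Qed.

(** By Fubini, the differentiated coordinate may be integrated first: for the
    first coordinate this is the fundamental theorem of calculus on the line,
    for the others the induction hypothesis on the remaining variables. *)
Lemma integral_partial0 n (p : 'rV[R]_n -> R) (i : 'I_n) (K : R) : 0 < K ->
  (forall x, derivable p x (ebasis R i)) -> continuous (partial i p) ->
  (forall (x : 'rV[R]_n) j, K <= `|x ord0 j| -> p x = 0) ->
  (forall (x : 'rV[R]_n) j, K <= `|x ord0 j| -> partial i p x = 0) ->
  (\int[leb R n]_x (partial i p x)%:E = 0)%E.
Proof.
move=> K0; elim: n p i => [p []//|n IH p i dp cp p0 dp0].
pose BK := [set x : 'rV[R]_n.+1 | forall j, (`[- K, K]%classic : set R) (x ord0 j)].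
have cBK : compact BK.
  by apply: (rV_compact (fun _ => @segment_compact R (- K) K)).
have BKP x : ~ BK x -> partial i p x = 0.
  move=> /existsNP[j]; rewrite /= in_itv/= => /negP.
  by rewrite -ler_norml -ltNge => /ltW /dp0.
have [C hC] : exists C : R, forall x, `|partial i p x| <= C.
  have : compact (partial i p @` BK).
    by apply: continuous_compact => //; apply: continuous_subspaceT.
  move/compact_bounded => [C [_ hC]]; exists (`|C| + 1) => x.
  have [xB|/BKP ->] := pselect (BK x); last by rewrite normr0 addr_ge0.
  by apply: (hC (`|C| + 1)) => //; rewrite (le_lt_trans (ler_norm _))// ltrDl.
have mdp : measurable_fun setT (partial i p) by exact: continuous_measurable_rV.
pose I : set (measurableTypeR R) := [set` `[- K, K]].
have mI : measurable I by exact: measurable_itv.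
have mB : measurable (I `*` ball (0 : 'rV[R]_n) (K + 1)).
  by apply: measurableX => //; exact: measurable_rV_ball.
have int : (mu \x leb R n)%E.-integrable setT
    (EFin \o (partial i p \o @rV_cons R n)).
  have := @integrable_finite_support _ _ (mu \x leb R n)%E
    (partial i p \o @rV_cons R n) _ C mB.
  apply; last 2 first.
  - by move=> z; exact: hC.
  - move=> [a v] /= nB; apply: BKP => h; apply: nB; split => /=.
      by have := h ord0; rewrite !mxE unlift_none.
    apply/rV_ballP => [|j]; first lra.
    have := h (lift ord0 j); rewrite !mxE liftK /= sub0r normrN in_itv/= -ler_norml.
    lra.
  - have E : (mu \x leb R n)%E (I `*` ball (0 : 'rV[R]_n) (K + 1)) =
        (mu I * leb R n (ball (0%R : 'rV[R]_n) (K + 1)%R))%E.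
      exact: product_measure1E mI (measurable_rV_ball 0 (K + 1)).
    apply: (@le_lt_trans _ _ (mu I * leb R n (ball (0%R : 'rV[R]_n) (K + 1)%R))%E).
      by rewrite le_eqVlt; apply/orP; left; apply/eqP; exact: E.
    rewrite lte_mul_pinfty//.
      by rewrite lebesgue_measure_itv/=; case: ifP.
    apply: leb_bounded_lty; first exact: measurable_rV_ball.
    exists (K + 1); split; first exact: num_real.
    move=> M KM x; rewrite mx_norm_ball /ball_ /= sub0r normrN => h.
    exact: ltW (lt_trans h KM).
  - by apply: measurableT_comp => //; exact: measurable_rV_cons.
rewrite (integral_leb_cons (f := EFin \o partial i p))//; last first.
  exact/measurable_EFinP.
case: (unliftP ord0 i) => [j ij|i0].
- rewrite -(integral12_prod_meas1 int) /fubini_F.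
  apply: integral0_eq => a _ /=.
  have pE v : partial j (fun w => p (rV_cons (a, w))) v = partial i p (rV_cons (a, v)).
    rewrite /partial /derive ij; apply: (congr1 (fun F : R -> R => lim (F @ 0^'))).
    by apply/funext => h /=; rewrite rV_cons_shift_lift.
  under eq_integral do rewrite -pE.
  apply: IH.
  + move=> v; have := dp (rV_cons (a, v)); rewrite /derivable ij.
    rewrite (_ : (fun h => _) = (fun h => h^-1 *:
      (((fun w => p (rV_cons (a, w))) \o shift v) (h *: ebasis R j) -
       p (rV_cons (a, v)))))//.
    by apply/funext => h /=; rewrite rV_cons_shift_lift.
  + rewrite (_ : partial _ _ = (partial i p) \o (fun v => rV_cons (a, v))); last first.
      by apply/funext => v; exact: pE.
    by move=> v; apply: continuous_comp; [exact: rV_cons_continuousr|exact: cp].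
  + by move=> v k h; apply: (p0 _ (lift ord0 k)); rewrite !mxE liftK.
  + by move=> v k h; rewrite pE; apply: (dp0 _ (lift ord0 k)); rewrite !mxE liftK.
- rewrite -(integral21_prod_meas1 int) /fubini_G.
  apply: integral0_eq => v _ /=.
  apply: (@integral_derive_compact (fun a => p (rV_cons (a, v))) _ K) => //.
  + move=> a; have := derivableP (dp (rV_cons (a, v))); rewrite /partial i0.
    move=> [h1 h2]; split.
    * move: h1; rewrite /derivable; set f := (fun h => _); set f' := (fun h => _).
      rewrite (_ : f = f')//.
      by apply/funext => h; rewrite /f /f' /= -rV_cons_shift0 [h%:A]mulr1.
    * rewrite -h2 /derive; apply: (congr1 (fun F : R -> R => lim (F @ 0^'))).
      by apply/funext => h /=; rewrite -rV_cons_shift0 [h%:A]mulr1.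
  + by move=> a; apply: continuous_comp; [exact: rV_cons_continuousl|exact: cp].
  + by move=> a h; apply: (p0 _ ord0); rewrite !mxE unlift_none.
  + by move=> a h; apply: (dp0 _ ord0); rewrite !mxE unlift_none.
Qed.

End integral_partial.

(** * Square integrable functions *)

Section L2.
Variables (R : realType) (n : nat) (Om : set 'rV[R]_n).
Hypothesis mOm : measurable Om.
Implicit Types f g h : 'rV[R]_n -> R.

Lemma inL2_measurable f : inL2 Om f -> measurable_fun Om f.
Proof. by case. Qed.

Lemma inL2_le f g : measurable_fun Om f -> inL2 Om g ->
  (forall x, Om x -> `|f x| <= `|g x|) -> inL2 Om f.
Proof.
move=> mf [mg goo] fg; split => //; apply: le_lt_trans goo.
apply: ge0_le_integral => //.
- by move=> x _; rewrite lee_fin sqr_ge0.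
- by apply/measurable_EFinP; exact: measurable_funX.
- by apply/measurable_EFinP; exact: measurable_funX.
- move=> x /fg; rewrite lee_fin -(real_normK (num_real (f x))) => h.
  by rewrite -(real_normK (num_real (g x))) lerXn2r ?nnegrE.
Qed.

Lemma inL2_sqr_integrable f : inL2 Om f ->
  (leb R n).-integrable Om (EFin \o (fun x => f x ^+ 2)).
Proof.
move=> [mf foo]; apply/integrableP; split.
  by apply/measurable_EFinP; exact: measurable_funX.
under eq_integral do rewrite /= ger0_norm ?sqr_ge0//.
exact: foo.
Qed.

Lemma inL2_integrableM f g : inL2 Om f -> inL2 Om g ->
  (leb R n).-integrable Om (EFin \o (fun x => f x * g x)).
Proof.
move=> f2 g2; have [mf _] := f2; have [mg _] := g2.
have := integrableD mOm (inL2_sqr_integrable f2) (inL2_sqr_integrable g2).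
apply: le_integrable => //; first by apply/measurable_EFinP; exact: measurable_funM.
move=> x _ /=; rewrite lee_fin normrM [leRHS]ger0_norm ?addr_ge0 ?sqr_ge0//.
rewrite -(real_normK (num_real (f x))) -(real_normK (num_real (g x))).
have := sqr_ge0 (`|f x| - `|g x|); have := normr_ge0 (f x).
have := normr_ge0 (g x); nra.
Qed.

Lemma inL2Z (a : R) f : inL2 Om f -> inL2 Om (fun x => a * f x).
Proof.
move=> f2; have [mf foo] := f2; split; first exact: measurable_funM.
have := integrableZl mOm (a ^+ 2) (inL2_sqr_integrable f2).
move/integrableP => [_]; apply: le_lt_trans; apply: ge0_le_integral => //.
- by move=> x _; rewrite lee_fin sqr_ge0.
- by apply/measurable_EFinP; apply: measurable_funX; exact: measurable_funM.
- apply: measurableT_comp => //; apply/measurable_EFinP.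
  by apply: measurable_funM => //; exact: measurable_funX.
- by move=> x _ /=; rewrite lee_fin exprMn ler_norm.
Qed.

Lemma inL2D f g : inL2 Om f -> inL2 Om g -> inL2 Om (fun x => f x + g x).
Proof.
move=> f2 g2; have [mf _] := f2; have [mg _] := g2.
split; first exact: measurable_funD.
have := integrableD mOm (integrableZl mOm 2 (inL2_sqr_integrable f2))
  (integrableZl mOm 2 (inL2_sqr_integrable g2)).
move/integrableP => [_]; apply: le_lt_trans; apply: ge0_le_integral => //.
- by move=> x _; rewrite lee_fin sqr_ge0.
- by apply/measurable_EFinP; apply: measurable_funX; exact: measurable_funD.
- apply: measurableT_comp => //; apply/measurable_EFinP.
  by apply: measurable_funD; apply: measurable_funM => //; exact: measurable_funX.
- move=> x _ /=; rewrite lee_fin; apply: le_trans (ler_norm _).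
  by have := sqr_ge0 (f x - g x); nra.
Qed.

Lemma inL2N f : inL2 Om f -> inL2 Om (fun x => - f x).
Proof.
by move/(inL2Z (-1)); under eq_fun do rewrite mulN1r.
Qed.

Lemma inL2B f g : inL2 Om f -> inL2 Om g -> inL2 Om (fun x => f x - g x).
Proof. by move=> f2 g2; apply: inL2D => //; exact: inL2N. Qed.

Lemma inL2_0 : inL2 Om (fun=> 0).
Proof.
split => //; under eq_integral do rewrite expr0n/=.
by rewrite integral0.
Qed.

Lemma inL2_sum N (F : nat -> 'rV[R]_n -> R) : (forall k, inL2 Om (F k)) ->
  inL2 Om (fun x => \sum_(k < N) F k x).
Proof.
move=> F2; elim: N => [|N IH].
  by under eq_fun do rewrite big_ord0; exact: inL2_0.
by under eq_fun do rewrite big_ord_recr/=; exact: inL2D.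
Qed.

Lemma dotC f g : dotL2 Om f g = dotL2 Om g f.
Proof. by apply: eq_Rintegral => x _; rewrite mulrC. Qed.

Lemma eq_dotl f g h : (forall x, Om x -> f x = g x) -> dotL2 Om f h = dotL2 Om g h.
Proof. by move=> fg; apply: eq_Rintegral => x /set_mem xO; rewrite fg. Qed.

Lemma dotDl f g h : inL2 Om f -> inL2 Om g -> inL2 Om h ->
  dotL2 Om (fun x => f x + g x) h = dotL2 Om f h + dotL2 Om g h.
Proof.
move=> f2 g2 h2; rewrite /dotL2.
under eq_Rintegral do rewrite mulrDl.
by rewrite RintegralD//; exact: inL2_integrableM.
Qed.

Lemma dotZl (a : R) f h : inL2 Om f -> inL2 Om h ->
  dotL2 Om (fun x => a * f x) h = a * dotL2 Om f h.
Proof.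
move=> f2 h2; rewrite /dotL2.
under eq_Rintegral do rewrite -mulrA.
by rewrite RintegralZl//; exact: inL2_integrableM.
Qed.

Lemma dotBl f g h : inL2 Om f -> inL2 Om g -> inL2 Om h ->
  dotL2 Om (fun x => f x - g x) h = dotL2 Om f h - dotL2 Om g h.
Proof.
move=> f2 g2 h2; rewrite /dotL2.
under eq_Rintegral do rewrite mulrBl.
by rewrite RintegralB//; exact: inL2_integrableM.
Qed.

Lemma dot0l h : dotL2 Om (fun=> 0) h = 0.
Proof.
rewrite /dotL2 /Rintegral (eq_integral (cst 0%E)) ?integral0//.
by move=> x _; rewrite mul0r.
Qed.

Lemma dot_suml N (F : nat -> 'rV[R]_n -> R) h : (forall k, inL2 Om (F k)) ->
  inL2 Om h ->
  dotL2 Om (fun x => \sum_(k < N) F k x) h = \sum_(k < N) dotL2 Om (F k) h.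
Proof.
move=> F2 h2; elim: N => [|N IH].
  by rewrite big_ord0; under eq_fun do rewrite big_ord0; exact: dot0l.
rewrite big_ord_recr /= -IH -dotDl//; last exact: inL2_sum.
by under eq_fun do rewrite big_ord_recr/=.
Qed.

Lemma dot_ge0 f g : (forall x, Om x -> 0 <= f x * g x) -> 0 <= dotL2 Om f g.
Proof. exact: Rintegral_ge0. Qed.

Lemma dot_self_ge0 f : 0 <= dotL2 Om f f.
Proof. by apply: dot_ge0 => x _; rewrite -expr2 sqr_ge0. Qed.

Lemma le_dot f g f' g' : inL2 Om f -> inL2 Om g -> inL2 Om f' -> inL2 Om g' ->
  (forall x, Om x -> f x * g x <= f' x * g' x) -> dotL2 Om f g <= dotL2 Om f' g'.
Proof. by move=> *; apply: le_Rintegral => //; exact: inL2_integrableM. Qed.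

(** Nonnegativity of the quadratic polynomial t -> |f + t g|^2. *)
Lemma cauchy_schwarz f g : inL2 Om f -> inL2 Om g ->
  `|dotL2 Om f g| <= Num.sqrt (dotL2 Om f f) * Num.sqrt (dotL2 Om g g).
Proof.
move=> f2 g2; set a := dotL2 Om f f; set b := dotL2 Om f g; set c := dotL2 Om g g.
have q t : 0 <= a + 2 * t * b + t ^+ 2 * c.
  have tg2 := inL2Z t g2.
  have := dot_self_ge0 (fun x => f x + t * g x).
  have E h : inL2 Om h ->
      dotL2 Om (fun x => f x + t * g x) h = dotL2 Om f h + t * dotL2 Om g h.
    by move=> h2; rewrite dotDl// dotZl.
  rewrite E; last exact: inL2D.
  rewrite (dotC f) (dotC g) !E// (dotC g f) -/a -/b -/c.
  by congr (_ <= _); ring.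
have a0 : 0 <= a by exact: dot_self_ge0.
have c0 : 0 <= c by exact: dot_self_ge0.
rewrite -sqrtrM// -sqrtr_sqr ler_wsqrtr//.
have [c_eq0|c_neq0] := eqVneq c 0.
  rewrite c_eq0 mulr0; have [->|b0] := eqVneq b 0; first by rewrite expr0n.
  have := q (- (a + 1) / (2 * b)); rewrite c_eq0 mulr0 addr0.
  have -> : 2 * (- (a + 1) / (2 * b)) * b = - (a + 1) by field.
  lra.
have := q (- b / c).
have -> : a + 2 * (- b / c) * b + (- b / c) ^+ 2 * c = (a * c - b ^+ 2) / c.
  by field.
by rewrite pmulr_lge0 ?invr_gt0 ?lt_def ?c_neq0 ?c0// subr_ge0.
Qed.

Lemma cvgL2_dot0 (f_ : nat -> 'rV[R]_n -> R) f :
  (forall j, inL2 Om (f_ j)) -> inL2 Om f -> cvgL2 Om f_ f ->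
  dotL2 Om (fun x => f_ j x - f x) (fun x => f_ j x - f x) @[j --> \oo] --> 0.
Proof.
move=> fj2 f2 /fine_cvgP[_]; apply: cvg_trans.
by apply: near_eq_cvg; near=> j => /=.
Unshelve. all: by end_near. Qed.

Lemma cvg_dot (f_ : nat -> 'rV[R]_n -> R) f g :
  (forall j, inL2 Om (f_ j)) -> inL2 Om f -> inL2 Om g ->
  dotL2 Om (fun x => f_ j x - f x) (fun x => f_ j x - f x) @[j --> \oo] --> 0 ->
  dotL2 Om (f_ j) g @[j --> \oo] --> dotL2 Om f g.
Proof.
move=> fj2 f2 g2 cf.
have cs : Num.sqrt (dotL2 Om (fun x => f_ j x - f x) (fun x => f_ j x - f x)) *
   Num.sqrt (dotL2 Om g g) @[j --> \oo] --> 0.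
  rewrite -[X in _ --> X](mul0r (Num.sqrt (dotL2 Om g g))); apply: cvgMl.
  rewrite -[X in _ --> X]sqrtr0.
  exact: (continuous_cvg _ (@sqrt_continuous R 0)).
apply/subr_cvg0; apply/norm_cvg0P; apply: (squeeze_cvgr _ (cvg_cst 0) cs).
near=> j; rewrite normr_ge0/= -dotBl//; apply: cauchy_schwarz => //.
exact: inL2B.
Unshelve. all: by end_near. Qed.

End L2.

(** * Smooth functions and test functions *)

Section smooth_functions.
Variables (R : realType) (n : nat).
Implicit Types (f h : 'rV[R]_n -> R) (i : 'I_n).

Lemma is_derive_lineP f (x v : 'rV[R]_n) (d : R) :
  is_derive x v f d <-> is_derive (0 : R) 1 (fun h : R => f (h *: v + x)) d.
Proof.
have E : (fun h : R => h^-1 *: ((f \o shift x) (h *: v) - f x)) =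
    (fun h : R => h^-1 *: (((fun k : R => f (k *: v + x)) \o shift 0) (h *: 1) -
                     f ((0:R) *: v + x))).
  by apply/funext => h /=; rewrite addr0 scale0r add0r [h *: 1]mulr1.
split => -[h1 h2]; split; rewrite /derivable /derive.
- by rewrite -E.
- by rewrite -E.
- by rewrite E.
- by rewrite E.
Qed.

Lemma is_derive_comp_line (G : R -> R) f (x v : 'rV[R]_n) :
  derivable G (f x) 1 -> derivable f x v ->
  is_derive x v (G \o f) (derive1 G (f x) * 'D_v f x).
Proof.
move=> dG /derivableP /is_derive_lineP df; apply/is_derive_lineP.
have dG' : is_derive ((fun h : R => f (h *: v + x)) 0) 1 G (derive1 G (f x)).
  by rewrite scale0r add0r derive1E; exact: derivableP.
have := is_derive1_comp dG' df.
by rewrite mulrC.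
Qed.

(** A family that is stable under partial derivatives contains its iterated
    derivatives, which reduces smoothness of products and compositions to the
    rules of first order. *)
Lemma smooth_coind (P : ('rV[R]_n -> R) -> Prop) :
  (forall f, P f -> [/\ continuous f, forall i x, derivable f x (ebasis R i) &
     forall i, P (partial i f)]) ->
  forall f, P f -> smooth f.
Proof.
move=> HP f Pf s; suff /HP[] : P (foldr (@partial R n) f s) by [].
by elim: s => //= i s /HP[].
Qed.

Lemma smooth_continuous f : smooth f -> continuous f.
Proof. by move/(_ [::]) => []. Qed.

Lemma smooth_derivable f i x : smooth f -> derivable f x (ebasis R i).
Proof. by move/(_ [::]) => []. Qed.

Lemma smooth_partial i f : smooth f -> smooth (partial i f).
Proof. by move=> sf s; have := sf (rcons s i); rewrite foldr_rcons. Qed.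

Definition smooth1 (G : R -> R) := forall k (x : R), derivable (derive1n k G) x 1.

Lemma smooth1_coind (P : (R -> R) -> Prop) :
  (forall G, P G -> (forall x : R, derivable G x 1) /\ P (derive1 G)) ->
  forall G, P G -> smooth1 G.
Proof.
move=> HP G PG k; suff /HP[] : P (derive1n k G) by [].
by elim: k => //= k /HP[].
Qed.

Lemma smooth1_of_derive1 G : (forall x : R, derivable G x 1) -> smooth1 (derive1 G) ->
  smooth1 G.
Proof. by move=> dG sG [|k]; [exact: dG|rewrite derive1Sn; exact: sG]. Qed.

Lemma smooth1_derive1 G : smooth1 G -> smooth1 (derive1 G).
Proof. by move=> sG k; rewrite -derive1Sn; exact: sG. Qed.

(** The algebra generated by smooth functions and their compositions with
    smooth functions of one variable; the product and chain rules show that it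
    is stable under partial derivatives. *)
Inductive smooth_gen : ('rV[R]_n -> R) -> Prop :=
| smooth_gen_cst c : smooth_gen (fun=> c)
| smooth_gen_smooth f : smooth f -> smooth_gen f
| smooth_gen_comp G f : smooth1 G -> smooth f -> smooth_gen (G \o f)
| smooth_genD f h : smooth_gen f -> smooth_gen h ->
    smooth_gen (fun x => f x + h x)
| smooth_genM f h : smooth_gen f -> smooth_gen h ->
    smooth_gen (fun x => f x * h x).

Lemma smooth_gen_continuous f : smooth_gen f -> continuous f.
Proof.
elim=> {f} [c x|f /smooth_continuous//|G f sG /smooth_continuous cf x
           |f h _ cf _ ch x|f h _ cf _ ch x].
- exact: cst_continuous.
- apply: continuous_comp; first exact: cf.
  by apply/differentiable_continuous/derivable1_diffP; exact: (sG 0).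
- exact: (continuousD (cf x) (ch x)).
- exact: (continuousM (cf x) (ch x)).
Qed.

Lemma smooth_gen_partial f : smooth_gen f ->
  (forall i x, derivable f x (ebasis R i)) /\
  (forall i, smooth_gen (partial i f)).
Proof.
elim=> {f} [c|f sf|G f sG sf|f h gf [df pf] gh [dh ph]|f h gf [df pf] gh [dh ph]].
- split => [i x|i]; first exact: derivable_cst.
  rewrite (_ : partial i _ = fun=> 0); first exact: smooth_gen_cst.
  by apply/funext => x; exact: derive_cst.
- split => [i x|i]; first exact: smooth_derivable.
  by apply: smooth_gen_smooth; exact: smooth_partial.
- have d i x := @is_derive_comp_line G f x (ebasis R i) (sG 0%N _) (smooth_derivable sf).
  split => [i x|i]; first by have := d i x => -[].
  rewrite (_ : partial i _ = fun x => (derive1 G \o f) x * partial i f x).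
    apply: smooth_genM; first by apply: smooth_gen_comp => //; exact: smooth1_derive1.
    by apply: smooth_gen_smooth; exact: smooth_partial.
  by apply/funext => x; have := d i x => -[].
- split => [i x|i]; first exact: derivableD.
  rewrite (_ : partial i _ = fun x => partial i f x + partial i h x).
    exact: smooth_genD.
  by apply/funext => x; exact: deriveD.
- split => [i x|i]; first exact: derivableM.
  rewrite (_ : partial i _ = fun x => f x * partial i h x + h x * partial i f x).
    by apply: smooth_genD; exact: smooth_genM.
  by apply/funext => x; exact: deriveM.
Qed.

Lemma smooth_gen_sub f : smooth_gen f -> smooth f.
Proof.
apply: smooth_coind => {}f gf; have [? ?] := smooth_gen_partial gf.
by split => //; exact: smooth_gen_continuous.
Qed.

Lemma smoothD f h : smooth f -> smooth h -> smooth (fun x => f x + h x).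
Proof. by move=> *; apply/smooth_gen_sub/smooth_genD; exact: smooth_gen_smooth. Qed.

Lemma smoothM f h : smooth f -> smooth h -> smooth (fun x => f x * h x).
Proof. by move=> *; apply/smooth_gen_sub/smooth_genM; exact: smooth_gen_smooth. Qed.

Lemma smooth_cst (c : R) : smooth (fun _ : 'rV[R]_n => c).
Proof. exact/smooth_gen_sub/smooth_gen_cst. Qed.

Lemma smooth_comp G f : smooth1 G -> smooth f -> smooth (G \o f).
Proof. by move=> *; apply/smooth_gen_sub/smooth_gen_comp. Qed.

End smooth_functions.

Section test_functions.
Variables (R : realType) (n : nat) (Om : set 'rV[R]_n).
Hypothesis (oOm : open Om) (bOm : bounded_set Om).
Implicit Types (psi chi : 'rV[R]_n -> R) (i : 'I_n).

Let mOm : measurable Om := open_measurable_rV oOm.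
Let Omfin : (leb R n Om < +oo)%E := leb_bounded_lty mOm bOm.

Lemma test_smooth psi : test_function Om psi -> smooth psi.
Proof. by case. Qed.

Lemma test_function0 : test_function Om (fun=> 0).
Proof.
split; first exact: smooth_cst.
by exists set0; split => //; exact: compact0.
Qed.

Lemma test_functionD psi chi : test_function Om psi -> test_function Om chi ->
  test_function Om (fun x => psi x + chi x).
Proof.
move=> [s1 [K1 [c1 K1O z1]]] [s2 [K2 [c2 K2O z2]]]; split; first exact: smoothD.
exists (K1 `|` K2); split; first exact: compactU.
- by rewrite subUset.
- by move=> x /not_orP[/z1 -> /z2 ->]; rewrite addr0.
Qed.

Lemma test_functionMl f psi : smooth f -> test_function Om psi ->
  test_function Om (fun x => f x * psi x).
Proof.
move=> sf [s1 [K1 [c1 K1O z1]]]; split; first exact: smoothM.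
by exists K1; split => // x /z1 ->; rewrite mulr0.
Qed.

Lemma test_functionZ (a : R) psi : test_function Om psi ->
  test_function Om (fun x => a * psi x).
Proof. by apply: test_functionMl; exact: smooth_cst. Qed.

Lemma test_function_comp (G : R -> R) psi : smooth1 G -> G 0 = 0 ->
  test_function Om psi -> test_function Om (G \o psi).
Proof.
move=> sG G0 [s1 [K1 [c1 K1O z1]]]; split; first exact: smooth_comp.
by exists K1; split => // x /z1 /= ->.
Qed.

Lemma partial_eq0 psi K i : compact K -> (forall x, ~ K x -> psi x = 0) ->
  forall x, ~ K x -> partial i psi x = 0.
Proof.
move=> cK z x nKx.
have oK : open (~` K).
  by apply: closed_openC; apply: compact_closed => //; exact: norm_hausdorff.
have : \forall y \near x, psi y = cst 0 y.
  have : nbhs x (~` K) by exact: open_nbhs_nbhs.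
  by apply: filterS => y /z.
by move/(near_eq_derive (ebasis R i)) => h; rewrite /partial h derive_cst.
Qed.

Lemma test_function_partial psi i : test_function Om psi ->
  test_function Om (partial i psi).
Proof.
move=> [s1 [K1 [c1 K1O z1]]]; split; first exact: smooth_partial.
by exists K1; split => // x; exact: partial_eq0.
Qed.

Lemma test_inL2 psi : test_function Om psi -> inL2 Om psi.
Proof.
move=> [s1 [K [cK KO z]]].
have mpsi : measurable_fun Om psi.
  apply: measurable_funS (continuous_measurable_rV (smooth_continuous s1)) => //.
split => //.
have [C hC] : exists C : R, forall x, `|psi x| <= C.
  have : compact (psi @` K).
    by apply: continuous_compact => //; apply: continuous_subspaceT; exact: smooth_continuous.
  move/compact_bounded => [C [_ hC]]; exists (`|C| + 1) => x.
  have [xB|/z ->] := pselect (K x); last by rewrite normr0 addr_ge0.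
  by apply: (hC (`|C| + 1)) => //; rewrite (le_lt_trans (ler_norm _))// ltrDl.
have : (leb R n).-integrable Om (EFin \o (fun x => psi x ^+ 2)).
  apply: measurable_bounded_integrable => //; first exact: measurable_funX.
  exists (C ^+ 2); split; first exact: num_real.
  move=> M CM x _ /=; apply: le_trans (ltW CM).
  by rewrite normrX lerXn2r ?nnegrE// (le_trans _ (hC x)).
move/integrableP => [_]; apply: le_lt_trans; apply: ge0_le_integral => //.
- by move=> x _; rewrite lee_fin sqr_ge0.
- by apply/measurable_EFinP; exact: measurable_funX.
- by apply: measurableT_comp => //; apply/measurable_EFinP; exact: measurable_funX.
- by move=> x _; rewrite lee_fin ler_norm.
Qed.

Lemma integral_partial_test psi i : test_function Om psi ->
  \int[leb R n]_(x in Om) partial i psi x = 0.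
Proof.
move=> t; have [s1 [K [cK KO z]]] := t.
have [C [_ hC]] := compact_bounded cK.
have out (x : 'rV[R]_n) j : `|C| + 2 <= `|x ord0 j| -> ~ K x.
  move=> Cx Kx; have := hC (`|C| + 1).
  rewrite (le_lt_trans (ler_norm _)) ?ltrDl// => /(_ isT x Kx) /= xC.
  have : `|x ord0 j| <= `|x|.
    by rewrite {2}/Num.norm /= mx_normrE; exact: (le_bigmax _ _ (ord0, j)).
  lra.
rewrite /Rintegral.
rewrite (_ : (\int[leb R n]_(x in Om) (partial i psi x)%:E = 0)%E)//.
rewrite -(@integral_partial0 R n psi i (`|C| + 2)).
- rewrite integral_mkcond; apply: eq_integral => x _.
  rewrite patchE; case: ifPn => //; rewrite notin_setE => nO.
  by rewrite (partial_eq0 i cK z)// => /KO.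
- by have := normr_ge0 C; lra.
- by move=> x; exact: smooth_derivable.
- by apply: smooth_continuous; exact: smooth_partial.
- by move=> x j /out /z.
- by move=> x j /out; exact: partial_eq0.
Qed.

(** The weak gradient identity for psi against chi says that the integral of the
    derivative of psi * chi vanishes; the approximating sequence is constant. *)
Lemma test_inH10 psi : test_function Om psi ->
  inH10 Om psi (fun i => partial i psi).
Proof.
move=> t; split; last first.
  exists (fun=> psi); split => //.
    rewrite /cvgL2; under eq_fun do under eq_integral do rewrite subrr expr0n/=.
    by rewrite integral0; exact: cvg_cst.
  move=> i; rewrite /cvgL2; under eq_fun do under eq_integral do rewrite subrr expr0n/=.
  by rewrite integral0; exact: cvg_cst.
have p2 i : inL2 Om (partial i psi) by apply/test_inL2/test_function_partial.
split => // [|chi i tc]; first exact: test_inL2.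
have ti : test_function Om (fun x => psi x * chi x).
  by apply: test_functionMl => //; exact: test_smooth.
have := integral_partial_test i ti.
have c2 : inL2 Om chi by exact: test_inL2.
have pc2 : inL2 Om (partial i chi) by apply/test_inL2/test_function_partial.
have psi2 : inL2 Om psi by exact: test_inL2.
under eq_Rintegral => x _.
  rewrite [partial _ _ _](_ : _ = psi x * partial i chi x + partial i psi x * chi x); last first.
    rewrite /partial [LHS]deriveM; last 2 first.
    - exact/smooth_derivable/test_smooth.
    - exact/smooth_derivable/test_smooth.
    by rewrite [in RHS](mulrC _ (chi x)).
  over.
have i1 := inL2_integrableM mOm psi2 pc2.
have i2 := inL2_integrableM mOm (p2 i) c2.
rewrite (RintegralD mOm i1 i2).
by move/eqP; rewrite addr_eq0 => /eqP.
Qed.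

End test_functions.

(** * A smooth truncation and its energy *)

Section soft_truncation.
Variables (R : realType) (e l : R).
Hypothesis e0 : 0 < e.

Definition soft_abs (s : R) : R := Num.sqrt ((s - l) ^+ 2 + e ^+ 2).

(** For l <= 0 this tends to s |-> - max (l - s) 0 as e -> 0.  It is
    nondecreasing and 1-Lipschitz, and normalized to vanish at 0, so that
    composing with it preserves compact supports. *)
Definition soft_trunc (s : R) : R := 2^-1 * (s - soft_abs s + soft_abs 0).

Lemma soft_abs_sqr s : soft_abs s ^+ 2 = (s - l) ^+ 2 + e ^+ 2.
Proof. by rewrite sqr_sqrtr// addr_ge0 ?sqr_ge0. Qed.

Lemma soft_abs_gt0 s : 0 < soft_abs s.
Proof. by rewrite sqrtr_gt0 ltr_wpDl ?sqr_ge0// exprn_gt0. Qed.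

Lemma le_soft_abs s : `|s - l| <= soft_abs s.
Proof. by rewrite -sqrtr_sqr ler_wsqrtr// lerDl sqr_ge0. Qed.

Lemma soft_abs_le s : soft_abs s <= `|s - l| + e.
Proof.
rewrite -[leRHS]ger0_norm; last by rewrite addr_ge0// ltW.
rewrite -sqrtr_sqr ler_wsqrtr// -(real_normK (num_real (s - l))).
have := mulr_ge0 (normr_ge0 (s - l)) (ltW e0); nra.
Qed.

Lemma is_derive_soft_abs (s : R) :
  is_derive s 1 soft_abs ((s - l) * (soft_abs s)^-1).
Proof.
have dg : is_derive s 1 (fun s => (s - l) ^+ 2 + e ^+ 2) (2 * (s - l)).
  apply: is_derive_eq.
  by rewrite /GRing.scale /=; ring.
have g0 : 0 < (fun s => (s - l) ^+ 2 + e ^+ 2) s by rewrite -sqrtr_gt0 soft_abs_gt0.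
apply: (is_derive_eq (@is_derive1_comp R Num.sqrt (fun s => (s - l) ^+ 2 + e ^+ 2)
  s _ _ (is_derive1_sqrt g0) dg)); rewrite -/(soft_abs s).
by field; rewrite gt_eqF// soft_abs_gt0.
Qed.

Lemma is_derive_soft_absV (s : R) :
  is_derive s 1 (fun s => (soft_abs s)^-1) (- (s - l) * (soft_abs s)^-1 ^+ 3).
Proof.
have q0 : soft_abs s != 0 by rewrite gt_eqF// soft_abs_gt0.
by apply: (is_derive_eq (is_deriveV q0 (is_derive_soft_abs s))); rewrite /GRing.scale /=; field.
Qed.

Lemma is_derive_soft_trunc (s : R) :
  is_derive s 1 soft_trunc (2^-1 * (1 - (s - l) * (soft_abs s)^-1)).
Proof.
have := is_derive_soft_abs s => dq.
by apply: is_derive_eq; rewrite /GRing.scale /=; ring.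
Qed.

Lemma soft_trunc_derive_itv s : 0 <= derive1 soft_trunc s <= 1.
Proof.
rewrite derive1E (@derive_val _ _ _ _ _ _ _ (is_derive_soft_trunc s)).
have := le_soft_abs s; rewrite ler_norml => /andP[h1 h2].
have q0 := soft_abs_gt0 s.
have : -1 <= (s - l) * (soft_abs s)^-1 <= 1.
  by rewrite ler_pdivrMr// mul1r h2 ler_pdivlMr// mulN1r h1.
by move=> /andP[? ?]; apply/andP; split; lra.
Qed.

(** The functions p(s) / soft_abs(s) ^ m with p a polynomial are stable under
    differentiation, and the second derivative of soft_trunc is one of them. *)
Lemma smooth1_soft_trunc : smooth1 soft_trunc.
Proof.
pose C (G : R -> R) := exists (p : {poly R}) m,
  G = fun s => p.[s] * (soft_abs s)^-1 ^+ m.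
have alg (q c a b : R) m : q != 0 ->
    a * ((m%:R * q^-1 ^+ m.-1) * (- c * q^-1 ^+ 3)) + q^-1 ^+ m * b =
    (b * q ^+ 2 - m%:R * (a * c)) * q^-1 ^+ m.+2.
  move=> q0; case: m => [|k]; first by rewrite expr0; field.
  by rewrite -[k.+1.-1]/k (exprS _ k.+2) (exprS _ k.+1) (exprS _ k); field.
have dC p m (s : R) : is_derive s 1 (fun s => p.[s] * (soft_abs s)^-1 ^+ m)
    ((p^`() * (('X - l%:P) ^+ 2 + (e ^+ 2)%:P) - m%:R *: (p * ('X - l%:P))).[s]
       * (soft_abs s)^-1 ^+ m.+2).
  have dp := is_derive_poly p s.
  have dV := is_derive_soft_absV s.
  have q0 : soft_abs s != 0 by rewrite gt_eqF// soft_abs_gt0.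
  have [H1 H2] := is_deriveM dp (is_deriveX m dV).
  rewrite (_ : (fun s => _) = horner p * (fun s => (soft_abs s)^-1) ^+ m); last first.
    by rewrite exprfctE.
  apply: DeriveDef; first exact: H1.
  apply: (etrans H2).
  rewrite exprfctE; apply: (etrans (alg _ (s - l) _ _ m q0)).
  congr (_ * _).
  by rewrite soft_abs_sqr !(hornerD, hornerN, hornerM, hornerZ, hornerC, hornerX, horner_exp).
have sC G : C G -> smooth1 G.
  apply: smooth1_coind => {}G [p [m ->]]; split => [s|]; first by have [] := dC p m s.
  exists (p^`() * (('X - l%:P) ^+ 2 + (e ^+ 2)%:P) - m%:R *: (p * ('X - l%:P)))%R, m.+2.
  by apply/funext => s; rewrite derive1E; have [] := dC p m s.
apply: smooth1_of_derive1 => [s|]; first by have [] := is_derive_soft_trunc s.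
have E : derive1 soft_trunc = fun s => 2^-1 * (1 - (s - l) * (soft_abs s)^-1).
  by apply/funext => s; rewrite derive1E; have [] := is_derive_soft_trunc s.
have d2 (s : R) : is_derive s 1 (derive1 soft_trunc)
    ((- (e ^+ 2) / 2)%:P.[s] * (soft_abs s)^-1 ^+ 3).
  rewrite E; have dV := is_derive_soft_absV s.
  apply: is_derive_eq; rewrite /GRing.scale /= hornerC.
  have q0 : soft_abs s != 0 by rewrite gt_eqF// soft_abs_gt0.
  have -> : e ^+ 2 = soft_abs s ^+ 2 - (s - l) ^+ 2 by rewrite soft_abs_sqr; ring.
  by field.
apply: smooth1_of_derive1 => [s|]; first by have [] := d2 s.
apply: sC; exists (- (e ^+ 2) / 2)%:P, 3%N.
by apply/funext => s; rewrite derive1E; have [] := d2 s.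
Qed.

Lemma soft_trunc0 : soft_trunc 0 = 0.
Proof. by rewrite /soft_trunc; ring. Qed.

Lemma soft_trunc_lipschitz a b : `|soft_trunc a - soft_trunc b| <= `|a - b|.
Proof.
have ha := soft_abs_gt0 a; have hb := soft_abs_gt0 b.
have : `|soft_abs a - soft_abs b| <= `|a - b|.
  have s0 : 0 < soft_abs a + soft_abs b by lra.
  rewrite -(ler_pM2r s0) -{1}(gtr0_norm s0) -normrM.
  have -> : (soft_abs a - soft_abs b) * (soft_abs a + soft_abs b) =
      (a - b) * ((a - l) + (b - l)).
    have -> : (soft_abs a - soft_abs b) * (soft_abs a + soft_abs b) =
      soft_abs a ^+ 2 - soft_abs b ^+ 2 by ring.
    by rewrite !soft_abs_sqr; ring.
  rewrite normrM ler_wpM2l// (le_trans (ler_normD _ _))//.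
  by rewrite lerD// le_soft_abs.
rewrite /soft_trunc.
have -> : 2^-1 * (a - soft_abs a + soft_abs 0) -
  2^-1 * (b - soft_abs b + soft_abs 0) =
  2^-1 * ((a - b) - (soft_abs a - soft_abs b)) by ring.
rewrite normrM ger0_norm; last lra.
have := ler_normB (a - b) (soft_abs a - soft_abs b).
lra.
Qed.

Lemma soft_trunc_approx s : l <= 0 ->
  `|soft_trunc s + Num.max (l - s) 0| <= e.
Proof.
move=> l0; rewrite /soft_trunc.
have h1 := le_soft_abs s; have h2 := soft_abs_le s.
have h3 := le_soft_abs 0; have h4 := soft_abs_le 0.
move: h3 h4; rewrite sub0r normrN ler0_norm// => h3 h4.
have [sl|ls] := leP (l - s) 0.
  by move: h1 h2; rewrite ger0_norm; [rewrite ler_norml => *; apply/andP; split; lra|lra].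
by move: h1 h2; rewrite ltr0_norm; [rewrite ler_norml => *; apply/andP; split; lra|lra].
Qed.

Lemma continuous_soft_trunc : continuous soft_trunc.
Proof.
move=> s; apply/differentiable_continuous/derivable1_diffP.
by have [] := is_derive_soft_trunc s.
Qed.

End soft_truncation.

Section energy.
Variables (R : realType) (n : nat) (Om : set 'rV[R]_n).
Hypothesis (oOm : open Om) (bOm : bounded_set Om).
Implicit Types (y z h psi : 'rV[R]_n -> R).

Let mOm : measurable Om := open_measurable_rV oOm.

(** The approximation half of membership in H^1_0, without the weak gradient
    identity; it passes directly to finite sums. *)
Definition approximable z (Z : 'I_n -> 'rV[R]_n -> R) :=
  exists psi_ : nat -> 'rV[R]_n -> R,
    [/\ forall j, test_function Om (psi_ j),
     dotL2 Om (fun x => psi_ j x - z x) (fun x => psi_ j x - z x) @[j --> \oo] --> 0 &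
     forall i, dotL2 Om (fun x => partial i (psi_ j) x - Z i x)
        (fun x => partial i (psi_ j) x - Z i x) @[j --> \oo] --> 0].

Lemma inL2_soft_trunc e l z : 0 < e -> inL2 Om z -> inL2 Om (soft_trunc e l \o z).
Proof.
move=> e0 z2; apply: (inL2_le mOm _ z2) => [|x _ /=].
  apply: measurableT_comp; last exact: inL2_measurable z2.
  by apply: continuous_measurable_fun; exact: continuous_soft_trunc.
have := soft_trunc_lipschitz l e0 (z x) 0.
by rewrite soft_trunc0 !subr0.
Qed.

(** If y = A z with A the Dirichlet Laplacian, then <y, F(z)> is formally the
    integral of F'(z) |grad z|^2, which is nonnegative.  Here F(z) is replaced by
    the test function F(psi_j), for test functions psi_j tending to z: with p a
    derivative of psi_j and q the same one of z, p q >= - (p - q)^2 / 4, so the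
    mismatch of the gradients costs an error that tends to 0. *)
Lemma energy_soft_trunc_ge0 e l y z Z : 0 < e ->
  inL2 Om y -> inL2 Om z -> (forall i, inL2 Om (Z i)) -> approximable z Z ->
  (forall h, test_function Om h ->
     \sum_(i < n) dotL2 Om (Z i) (partial i h) = dotL2 Om y h) ->
  0 <= dotL2 Om y (soft_trunc e l \o z).
Proof.
move=> e0 y2 z2 Z2 [psi [tpsi cpsi dpsi]] weak.
pose F := soft_trunc e l.
have psi2 j : inL2 Om (psi j) by exact: test_inL2.
have dpsi2 i j : inL2 Om (partial i (psi j)).
  by apply: test_inL2 => //; exact: test_function_partial.
have tF j : test_function Om (F \o psi j).
  by apply: test_function_comp => //; [exact: smooth1_soft_trunc|exact: soft_trunc0].
have cF : dotL2 Om y (F \o psi j) @[j --> \oo] --> dotL2 Om y (F \o z).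
  under eq_fun do rewrite dotC; rewrite dotC.
  apply: cvg_dot => // [j| |]; [exact: inL2_soft_trunc|exact: inL2_soft_trunc|].
  apply: (squeeze_cvgr _ (cvg_cst 0) cpsi); near=> j.
  rewrite dot_self_ge0/=; apply: le_dot => //.
  - by apply: inL2B => //; exact: inL2_soft_trunc.
  - by apply: inL2B => //; exact: inL2_soft_trunc.
  - exact: inL2B.
  - exact: inL2B.
  - move=> x _ /=; rewrite -!expr2 -[leLHS]real_normK ?num_real//.
    rewrite -[leRHS]real_normK ?num_real// lerXn2r ?nnegrE//.
    exact: soft_trunc_lipschitz.
pose D j := \sum_(i < n) (- 4^-1) * dotL2 Om (fun x => partial i (psi j) x - Z i x)
        (fun x => partial i (psi j) x - Z i x).
have cD : D j @[j --> \oo] --> 0.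
  rewrite (_ : 0 = \sum_(i < n) (- 4^-1) * 0); last first.
    by rewrite big1// => i _; rewrite mulr0.
  apply: cvg_big => [|i _]; first exact: add_continuous.
  by apply: cvgMr; exact: dpsi.
apply: (ler_cvg_to cD cF); near=> j.
rewrite -weak//; apply: ler_sum => i _.
have i2 : inL2 Om (fun x => partial i (psi j) x - Z i x) by exact: inL2B.
rewrite -dotZl//; apply: le_dot => //.
- exact: inL2Z.
- by apply: test_inL2 => //; exact: test_function_partial.
- move=> x _.
  have -> : partial i (F \o psi j) x = derive1 F (psi j x) * partial i (psi j) x.
    have sp : smooth (psi j) by exact: test_smooth.
    have dF : derivable F (psi j x) 1.
      by have [] := is_derive_soft_trunc l e0 (psi j x).
    by have [] := is_derive_comp_line dF (smooth_derivable (i := i) sp).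
  have /andP[] := soft_trunc_derive_itv l e0 (psi j x); rewrite -/F.
  set a := derive1 F _; set p := partial i _ x; set q := Z i x => a0 a1.
  have h1 : 0 <= p * q + 4^-1 * (p - q) ^+ 2.
    rewrite (_ : p * q + _ = 4^-1 * (p + q) ^+ 2); last by field.
    by rewrite mulr_ge0 ?sqr_ge0// invr_ge0.
  have h2 := sqr_ge0 (p - q).
  have h3 : 0 <= (1 - a) * (p - q) ^+ 2 by rewrite mulr_ge0// subr_ge0.
  have h4 : 0 <= a * (p * q + 4^-1 * (p - q) ^+ 2) by rewrite mulr_ge0.
  nra.
Unshelve. all: by end_near. Qed.

(** The limit e -> 0: soft_trunc is within e of the truncation, uniformly, and y
    is integrable because Om has finite measure. *)
Lemma energy_trunc_le0 l y z Z : l <= 0 ->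
  inL2 Om y -> inL2 Om z -> (forall i, inL2 Om (Z i)) -> approximable z Z ->
  (forall h, test_function Om h ->
     \sum_(i < n) dotL2 Om (Z i) (partial i h) = dotL2 Om y h) ->
  dotL2 Om y (fun x => Num.max (l - z x) 0) <= 0.
Proof.
move=> l0 y2 z2 Z2 aZ weak.
have m2 : inL2 Om (fun x => Num.max (l - z x) 0).
  apply: (inL2_le mOm _ z2) => [|x _ /=].
    apply: measurable_maxr => //; apply: measurable_funB => //.
    exact: inL2_measurable z2.
  have [_|h] := leP (l - z x) 0; first by rewrite normr0.
  by rewrite gtr0_norm// ltr0_norm; lra.
have y1 : (leb R n).-integrable Om (EFin \o (fun x => `|y x|)).
  have c2 : inL2 Om (fun _ => 1).
    split => //; rewrite integral_cst//= expr1n mul1e.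
    exact: leb_bounded_lty.
  have := integrable_abse (inL2_integrableM mOm y2 c2).
  by apply: eq_integrable => // x _ /=; rewrite mulr1.
set I := \int[leb R n]_(x in Om) `|y x|.
have I0 : 0 <= I by exact: Rintegral_ge0.
apply/ler_addgt0Pr => d d0; rewrite add0r.
pose e := d / (I + 1).
have e0 : 0 < e by rewrite divr_gt0// ltr_wpDl.
have F2 := inL2_soft_trunc l e0 z2.
have := energy_soft_trunc_ge0 l e0 y2 z2 Z2 aZ weak.
have : dotL2 Om y (soft_trunc e l \o z) + dotL2 Om y (fun x => Num.max (l - z x) 0) <= e * I.
  rewrite !(dotC Om y) -dotDl// dotC /dotL2 /I -RintegralZl//.
  apply: le_Rintegral => //.
  - by apply: inL2_integrableM => //; exact: inL2D.
  - exact: (integrableZl mOm e y1).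
  - move=> x _; rewrite (le_trans (ler_norm _))// normrM mulrC ler_wpM2r//.
    exact: soft_trunc_approx.
have : e * I <= d.
  rewrite /e mulrAC ler_pdivrMr; last by rewrite ltr_wpDl.
  by rewrite ler_pM2l// lerDl.
lra.
Qed.

End energy.

(** * Finite spectral sums and the Beurling-Deny inequality *)

Section approximable_combinations.
Variables (R : realType) (n : nat) (Om : set 'rV[R]_n).
Hypothesis (oOm : open Om) (bOm : bounded_set Om).
Implicit Types (y z h psi : 'rV[R]_n -> R).

Let mOm : measurable Om := open_measurable_rV oOm.

Notation sqL2 f := (dotL2 Om f f).

Lemma sqL2D_le f g : inL2 Om f -> inL2 Om g ->
  sqL2 (fun x => f x + g x) <= 2 * sqL2 f + 2 * sqL2 g.
Proof.
move=> f2 g2; rewrite -!dotZl//.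
rewrite /dotL2 -RintegralD//; last 2 first.
- by apply: inL2_integrableM => //; exact: inL2Z.
- by apply: inL2_integrableM => //; exact: inL2Z.
apply: le_Rintegral => //.
- by apply: inL2_integrableM => //; exact: inL2D.
- apply: (integrableD mOm (f := EFin \o (fun x => 2 * f x * f x))
    (g := EFin \o (fun x => 2 * g x * g x))).
  + by apply: inL2_integrableM => //; exact: inL2Z.
  + by apply: inL2_integrableM => //; exact: inL2Z.
- by move=> x _; have := sqr_ge0 (f x - g x); nra.
Qed.

Lemma cvg_sqL2D (f_ g_ : nat -> 'rV[R]_n -> R) f g :
  (forall j, inL2 Om (f_ j)) -> (forall j, inL2 Om (g_ j)) ->
  inL2 Om f -> inL2 Om g ->
  sqL2 (fun x => f_ j x - f x) @[j --> \oo] --> 0 ->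
  sqL2 (fun x => g_ j x - g x) @[j --> \oo] --> 0 ->
  sqL2 (fun x => f_ j x + g_ j x - (f x + g x)) @[j --> \oo] --> 0.
Proof.
move=> fj2 gj2 f2 g2 cf cg.
have cfg : 2 * sqL2 (fun x => f_ j x - f x) + 2 * sqL2 (fun x => g_ j x - g x)
    @[j --> \oo] --> 0.
  rewrite -[X in _ --> X]addr0 -[X in _ --> X + _](mulr0 2) -[X in _ --> _ + X](mulr0 2).
  by apply: cvgD; apply: cvgMr.
apply: (squeeze_cvgr _ (cvg_cst 0) cfg); near=> j.
rewrite dot_self_ge0/=.
have := @sqL2D_le (fun x => f_ j x - f x) (fun x => g_ j x - g x)
  (inL2B mOm (fj2 j) f2) (inL2B mOm (gj2 j) g2).
by under eq_fun do rewrite addrACA -opprD.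
Unshelve. all: by end_near. Qed.

Lemma cvg_sqL2Z a (f_ : nat -> 'rV[R]_n -> R) f :
  (forall j, inL2 Om (f_ j)) -> inL2 Om f ->
  sqL2 (fun x => f_ j x - f x) @[j --> \oo] --> 0 ->
  sqL2 (fun x => a * f_ j x - a * f x) @[j --> \oo] --> 0.
Proof.
move=> fj2 f2 cf.
rewrite (_ : (fun j => _) =
    (fun j => a * (a * sqL2 (fun x => f_ j x - f x)))); last first.
  apply/funext => j; under eq_fun do rewrite -mulrBr.
  have fjf : inL2 Om (fun x => f_ j x - f x) by exact: inL2B.
  by rewrite dotZl//; [rewrite dotC dotZl|exact: inL2Z].
rewrite -[X in _ --> X](mulr0 a); apply: cvgMr.
by rewrite -[X in _ --> X](mulr0 a); apply: cvgMr.
Qed.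

Lemma approximable0 : approximable Om (fun=> 0) (fun _ _ => 0).
Proof.
exists (fun _ _ => 0); split => [j||i]; first exact: test_function0.
  by under eq_fun do under eq_fun do rewrite subrr; under eq_fun do rewrite dot0l; exact: cvg_cst.
under eq_fun do under eq_fun do rewrite /partial derive_cst subrr.
by under eq_fun do rewrite dot0l; exact: cvg_cst.
Qed.

Lemma approximableZD a z Z y Y :
  inL2 Om z -> inL2 Om y -> (forall i, inL2 Om (Z i)) -> (forall i, inL2 Om (Y i)) ->
  approximable Om z Z -> approximable Om y Y ->
  approximable Om (fun x => y x + a * z x) (fun i x => Y i x + a * Z i x).
Proof.
move=> z2 y2 Z2 Y2 [p [tp cp dp]] [q [tq cq dq]].
have p2 j : inL2 Om (p j) by exact: test_inL2.
have q2 j : inL2 Om (q j) by exact: test_inL2.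
have dp2 i j : inL2 Om (partial i (p j)) by apply: test_inL2 => //; exact: test_function_partial.
have dq2 i j : inL2 Om (partial i (q j)) by apply: test_inL2 => //; exact: test_function_partial.
exists (fun j x => q j x + a * p j x); split => [j||i].
- by apply: test_functionD => //; exact: test_functionZ.
- by apply: cvg_sqL2D => // [j||]; [exact: inL2Z|exact: inL2Z|exact: cvg_sqL2Z].
- have E j x : partial i (fun x => q j x + a * p j x) x =
      partial i (q j) x + a * partial i (p j) x.
    have dpj : derivable (p j) x (ebasis R i) by exact/smooth_derivable/test_smooth.
    have dqj : derivable (q j) x (ebasis R i) by exact/smooth_derivable/test_smooth.
    rewrite /partial [LHS]deriveD//; last exact: derivableZ.
    by congr (_ + _); exact: deriveZ.
  under eq_fun do under eq_fun do rewrite E.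
  by apply: cvg_sqL2D => // [j||]; [exact: inL2Z|exact: inL2Z|exact: cvg_sqL2Z].
Qed.

Lemma approximable_sum (N : nat) (a : nat -> R) (z : nat -> 'rV[R]_n -> R) Z :
  (forall k, inL2 Om (z k)) -> (forall k i, inL2 Om (Z k i)) ->
  (forall k, approximable Om (z k) (Z k)) ->
  approximable Om (fun x => \sum_(k < N) a k * z k x)
    (fun i x => \sum_(k < N) a k * Z k i x).
Proof.
move=> z2 Z2 az; elim: N => [|N IH].
  have -> : (fun x : 'rV[R]_n => \sum_(k < 0) a k * z k x) = fun=> 0.
    by apply/funext => x; rewrite big_ord0.
  have -> : (fun (i : 'I_n) (x : 'rV[R]_n) => \sum_(k < 0) a k * Z k i x) = fun _ _ => 0.
    by apply/funext => i; apply/funext => x; rewrite big_ord0.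
  exact: approximable0.
under eq_fun do rewrite big_ord_recr/=.
have -> : (fun (i : 'I_n) (x : 'rV[R]_n) => \sum_(k < N.+1) a k * Z k i x) =
    fun i x => \sum_(k < N) a k * Z k i x + a N * Z N i x.
  by apply/funext => i; apply/funext => x; rewrite big_ord_recr.
apply: approximableZD => // [|i].
- by apply: (@inL2_sum _ _ _ mOm N (fun k x => a k * z k x)) => k; exact: inL2Z.
- by apply: (@inL2_sum _ _ _ mOm N (fun k x => a k * Z k i x)) => k; exact: inL2Z.
Qed.

End approximable_combinations.

Section markov.
Variables (R : realType) (n : nat) (Om : set 'rV[R]_n).
Hypothesis (oOm : open Om) (bOm : bounded_set Om).
Variables (lam : nat -> R) (phi : nat -> 'rV[R]_n -> R).
Hypothesis eig : dirichlet_eigenbasis Om lam phi.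
Implicit Types (f v w : 'rV[R]_n -> R).

Let mOm : measurable Om := open_measurable_rV oOm.

Notation coef f k := (dotL2 Om f (phi k)).

Definition combination (a : nat -> R) N : 'rV[R]_n -> R :=
  fun x => \sum_(k < N) a k * phi k x.

Lemma eigenfunction_inL2 k : inL2 Om (phi k).
Proof. by have [[]] := eig. Qed.

Lemma inL2_combination a N : inL2 Om (combination a N).
Proof.
apply: (@inL2_sum _ _ _ mOm N (fun k x => a k * phi k x)) => k.
by apply: inL2Z => //; exact: eigenfunction_inL2.
Qed.

Lemma dot_combination a N w : inL2 Om w ->
  dotL2 Om (combination a N) w = \sum_(k < N) a k * coef w k.
Proof.
move=> w2; rewrite (@dot_suml _ _ _ mOm N (fun k x => a k * phi k x))// => [|k].
  apply: eq_bigr => k _; rewrite dotZl//; last exact: eigenfunction_inL2.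
  by rewrite dotC.
by apply: inL2Z => //; exact: eigenfunction_inL2.
Qed.

Lemma coef_combination a N k :
  coef (combination a N) k = if (k < N)%N then a k else 0.
Proof.
rewrite dot_combination; last exact: eigenfunction_inL2.
have [[_ on _] _] := eig.
under eq_bigr do rewrite on.
case: ifPn => kN.
  rewrite (bigD1 (Ordinal kN))//= eqxx mulr1 big1 ?addr0// => j jk.
  rewrite (_ : (k == j)%N = false) ?mulr0//.
  by apply: contraNF jk => /eqP kj; apply/eqP/val_inj.
rewrite big1// => j _; rewrite (_ : (k == j)%N = false) ?mulr0//.
by apply: contraNF kN => /eqP ->.
Qed.

Definition expansion f N := combination (fun k => coef f k) N.

Definition expansion_error f N : R :=
  dotL2 Om (fun x => expansion f N x - f x) (fun x => expansion f N x - f x).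

Lemma cvg_expansion f : inL2 Om f -> expansion_error f N @[N --> \oo] --> 0.
Proof.
move=> f2; have [[_ _ cv] _] := eig.
apply: cvgL2_dot0 => //; [by move=> N; exact: inL2_combination|exact: cv].
Qed.

Lemma bessel f N : inL2 Om f -> \sum_(k < N) coef f k ^+ 2 <= dotL2 Om f f.
Proof.
move=> f2; pose s := combination (fun k => coef f k) N.
have s2 : inL2 Om s by exact: inL2_combination.
have sf : dotL2 Om s f = \sum_(k < N) coef f k ^+ 2.
  by rewrite dot_combination.
have ss : dotL2 Om s s = \sum_(k < N) coef f k ^+ 2.
  rewrite {1}/s dot_combination//; apply: eq_bigr => k _.
  by rewrite coef_combination ltn_ord.
have := dot_self_ge0 Om (fun x => f x - s x).
rewrite dotBl//; last exact: inL2B.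
rewrite (dotC Om f) (dotC Om s) !dotBl// sf ss (dotC Om f s) sf.
lra.
Qed.

Lemma eigenvalue_ge0 k : 0 <= lam k.
Proof.
have [[_ on _] /(_ k)[_ [G hG w]]] := eig.
have := w _ _ hG; rewrite on eqxx mulr1 => <-.
by apply: sumr_ge0 => i _; exact: dot_self_ge0.
Qed.

Definition eigen_gradient k (Gk : 'I_n -> 'rV[R]_n -> R) :=
  [/\ forall i, inL2 Om (Gk i), approximable Om (phi k) Gk &
    forall h, test_function Om h ->
      \sum_(i < n) dotL2 Om (Gk i) (partial i h) = lam k * dotL2 Om (phi k) h].

Lemma eigenfunction_gradient : exists G, forall k, eigen_gradient k (G k).
Proof.
suff /choice[G hG] : forall k, exists Gk, eigen_gradient k Gk by exists G.
move=> k; have [_ /(_ k)[_ [G [[_ G2 _] [psi [tp cp dp]]] w]]] := eig.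
exists G; split => //; last by move=> h th; apply: w; exact: test_inH10.
exists psi; split => // [|i]; apply: cvgL2_dot0 => //.
- by move=> j; exact: test_inL2.
- exact: eigenfunction_inL2.
- by move=> j; apply: test_inL2 => //; exact: test_function_partial.
Qed.

Lemma combination_trunc_le0 (a : nat -> R) N l : l <= 0 ->
  dotL2 Om (combination (fun k => a k * lam k) N)
    (fun x => Num.max (l - combination a N x) 0) <= 0.
Proof.
move=> l0; have [G hG] := eigenfunction_gradient.
have G2 k i : inL2 Om (G k i) by have [] := hG k.
have phi2 := eigenfunction_inL2.
apply: (@energy_trunc_le0 _ _ _ oOm bOm l _ _ (fun i x => \sum_(k < N) a k * G k i x)) => //.
- exact: inL2_combination.
- exact: inL2_combination.
- by move=> i; apply: (@inL2_sum _ _ _ mOm N (fun k x => a k * G k i x)) => k; exact: inL2Z.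
- by apply: approximable_sum => // k; have [] := hG k.
- move=> h th; have h2 := test_inL2 oOm bOm th.
  rewrite dot_combination//.
  have dh2 i : inL2 Om (partial i h) by apply: test_inL2 => //; exact: test_function_partial.
  under eq_bigr => i _.
    rewrite (@dot_suml _ _ _ mOm N (fun k x => a k * G k i x))//; last first.
      by move=> k; exact: inL2Z.
    over.
  rewrite exchange_big/=; apply: eq_bigr => k _.
  under eq_bigr do rewrite dotZl//.
  have [_ _ /(_ _ th) E] := hG k.
  by rewrite -mulr_sumr E mulrA (dotC Om h).
Qed.

Lemma inL2_maxr f l : inL2 Om f -> l <= 0 -> inL2 Om (fun x => Num.max (f x) l).
Proof.
move=> f2 l0; apply: (inL2_le mOm _ f2) => [|x _].
  by apply: measurable_maxr => //; exact: inL2_measurable f2.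
by have [h|//] := leP (f x) l; rewrite !ler0_norm//; lra.
Qed.

Lemma inL2_trunc f l : inL2 Om f -> l <= 0 ->
  inL2 Om (fun x => Num.max (l - f x) 0).
Proof.
move=> f2 l0; apply: (inL2_le mOm _ f2) => [|x _].
  apply: measurable_maxr => //; apply: measurable_funB => //.
  exact: inL2_measurable f2.
have [h|h] := leP (l - f x) 0; first by rewrite normr0.
by rewrite gtr0_norm// ltr0_norm; lra.
Qed.

Definition resolvent mu f N :=
  combination (fun k => mu / (lam k + mu) * coef f k) N.

(** The partial sums z and bN satisfy mu z + A z = mu bN exactly, so testing with
    q = max (l - z) 0 gives <bN - z, q> <= 0, whereas b >= l gives
    <b - z, q> >= <q, q>.  Hence |q|^2 <= <b - bN, q>: the resolvent is Markovian
    up to the error made in expanding b. *)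
Lemma resolvent_lower_bound b l mu N : inL2 Om b -> l <= 0 -> 0 < mu ->
  (forall x, Om x -> l <= b x) ->
  dotL2 Om (fun x => Num.max (l - resolvent mu b N x) 0)
    (fun x => Num.max (l - resolvent mu b N x) 0) <= expansion_error b N.
Proof.
move=> b2 l0 mu0 lb; rewrite /expansion_error.
set z := resolvent mu b N; set bN := expansion b N; set q := fun x => Num.max (l - z x) 0.
have z2 : inL2 Om z by exact: inL2_combination.
have bN2 : inL2 Om bN by exact: inL2_combination.
have q2 : inL2 Om q by exact: inL2_trunc.
have bNb2 : inL2 Om (fun x => bN x - b x) by exact: inL2B.
have : dotL2 Om (fun x => bN x - z x) q <= 0.
  have := @combination_trunc_le0 (fun k => mu / (lam k + mu) * coef b k) N l l0.
  rewrite -/z -/q => h.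
  have : mu * dotL2 Om (fun x => bN x - z x) q <= 0.
    rewrite -dotZl//; last exact: inL2B.
    move: h; congr (_ <= _); apply: eq_dotl => x _.
    rewrite /bN /z /expansion /resolvent /combination -sumrB mulr_sumr; apply: eq_bigr => k _.
    have := eigenvalue_ge0 k => lk; field.
    by rewrite gt_eqF// ltr_wpDl.
  by rewrite pmulr_rle0.
have : dotL2 Om q q <= dotL2 Om (fun x => b x - z x) q.
  apply: le_dot => //; first exact: inL2B.
  move=> x xO; rewrite /q; have [h|h] := leP (l - z x) 0; first by rewrite !mulr0.
  by apply: ler_wpM2r; [exact: ltW|rewrite lerD2r lb].
rewrite !(dotBl mOm _ _ q2)//.
have dq : dotL2 Om (fun x => bN x - b x) q = dotL2 Om bN q - dotL2 Om b q.
  by rewrite dotBl.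
move: dq bNb2; set d := fun x => bN x - b x => dq d2; clearbody d.
have dq2 : inL2 Om (fun x => d x + q x) by exact: inL2D.
have := dot_self_ge0 Om (fun x => d x + q x).
rewrite dotDl// (dotC Om d) (dotC Om q) !dotDl// (dotC Om q d) dq.
lra.
Qed.

(** Write v = b - w with b = max v l, and let P be the resolvent mu (mu + A)^-1.
    Then <v - P v, w> = (<b, w> - <P b, w>) - <w - P w, w>, where P is a contraction
    and P b >= l, which is the value of b wherever w > 0.  The error, due to the
    expansion of b, does not depend on mu. *)
Lemma yosida_pairing_le v l mu N : inL2 Om v -> l <= 0 -> 0 < mu ->
  \sum_(k < N) lam k / (lam k + mu) *
    (coef v k * coef (fun x => Num.max (l - v x) 0) k) <=
  2 * (Num.sqrt (expansion_error (fun x => Num.max (v x) l) N) *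
       Num.sqrt (dotL2 Om (fun x => Num.max (l - v x) 0)
                          (fun x => Num.max (l - v x) 0))).
Proof.
move=> v2 l0 mu0; rewrite /expansion_error; set w := fun x => Num.max (l - v x) 0.
set b := fun x => Num.max (v x) l; set bN := expansion b N.
have w2 : inL2 Om w by exact: inL2_trunc.
have b2 : inL2 Om b by exact: inL2_maxr.
have bN2 : inL2 Om bN by exact: inL2_combination.
pose p k := mu / (lam k + mu).
pose z := resolvent mu b N.
have z2 : inL2 Om z by exact: inL2_combination.
pose q := fun x => Num.max (l - z x) 0.
have q2 : inL2 Om q by exact: inL2_trunc.
have vbw : v = fun x => b x - w x.
  apply/funext => x; rewrite /b /w.
  by have [h|h] := leP (v x) l; have [h'|h'] := leP (l - v x) 0; lra.
have vk k : coef v k = coef b k - coef w k.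
  by rewrite {1}vbw dotBl//; exact: eigenfunction_inL2.
have step1 : \sum_(k < N) lam k / (lam k + mu) * (coef v k * coef w k) <=
    dotL2 Om bN w - dotL2 Om z w.
  rewrite !dot_combination// -sumrB; apply: ler_sum => k _.
  rewrite vk /p; have lk := eigenvalue_ge0 k.
  have d0 : 0 < lam k + mu by rewrite ltr_wpDl.
  have : 0 <= lam k / (lam k + mu) * coef w k ^+ 2.
    by rewrite mulr_ge0 ?sqr_ge0// divr_ge0// ltW.
  have -> : mu / (lam k + mu) = 1 - lam k / (lam k + mu) by field; rewrite gt_eqF.
  lra.
have step2 : dotL2 Om b w - dotL2 Om z w <= dotL2 Om q w.
  rewrite -dotBl//; apply: le_dot => //; first exact: inL2B.
  move=> x _; rewrite /w; have [h|h] := leP (l - v x) 0; first by rewrite !mulr0.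
  apply: ler_wpM2r; first exact: ltW.
  rewrite /b /q.
  by have [h1|h1] := leP (v x) l; have [h2|h2] := leP (l - z x) 0; lra.
have step3 : dotL2 Om q w <=
    Num.sqrt (dotL2 Om (fun x => bN x - b x) (fun x => bN x - b x)) *
    Num.sqrt (dotL2 Om w w).
  rewrite (le_trans (ler_norm _))// (le_trans (cauchy_schwarz mOm q2 w2))//.
  rewrite ler_wpM2r ?sqrtr_ge0// ler_wsqrtr//.
  apply: resolvent_lower_bound => // x _; rewrite /b.
  by have [h|h] := leP (v x) l; [|exact: ltW].
have step4 : dotL2 Om bN w - dotL2 Om b w <=
    Num.sqrt (dotL2 Om (fun x => bN x - b x) (fun x => bN x - b x)) *
    Num.sqrt (dotL2 Om w w).
  rewrite -dotBl// (le_trans (ler_norm _))// cauchy_schwarz//.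
  exact: inL2B.
lra.
Qed.

End markov.

(** * Fractional powers as mixtures of resolvents *)

Section subordination.
Variables (R : realType) (alpha : R).
Hypothesis alpha01 : 0 < alpha < 1.
Notation mu := (@lebesgue_measure R).

Let alpha0 : 0 < alpha. Proof. by case/andP: alpha01. Qed.
Let alpha1 : alpha < 1. Proof. by case/andP: alpha01. Qed.

(** In the variable t = mu ^ alpha, the integral of lambda / (lambda + mu) against
    mu ^ (alpha - 1) d mu becomes that of lambda / (lambda + t ^ (1 / alpha)) dt up
    to a constant; rescaling t by lambda ^ alpha leaves this kernel. *)
Definition kern (s : R) : R := (1 + s `^ alpha^-1)^-1.

Definition kern_int (x : R) : R := \int[mu]_(s in `[0, x]) kern s.

Let den_gt0 s : 0 < 1 + s `^ alpha^-1.
Proof. by rewrite ltr_pwDl// powR_ge0. Qed.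

Lemma kern_ge0 s : 0 <= kern s.
Proof. by rewrite invr_ge0 ltW. Qed.

Lemma kern_le1 s : kern s <= 1.
Proof. by rewrite invf_le1// lerDl powR_ge0. Qed.

Let mu_itv_lty (x : R) : (mu `[0%R, x]%classic < +oo)%E.
Proof. by rewrite lebesgue_measure_itv/=; case: ifP => //; rewrite -EFinD ltry. Qed.

Lemma kern_integrable x : mu.-integrable `[0, x] (EFin \o kern).
Proof.
apply: measurable_bounded_integrable => //.
- exact: mu_itv_lty.
- apply: measurable_funTS.
  have -> : kern = fun s => (1 + s `^ alpha^-1) `^ (-1).
    by apply/funext => s; rewrite powR_inv1// ltW.
  apply: (measurableT_comp (measurable_powR (-1))) => //.
  by apply: measurable_funD => //; exact: measurable_powR.
- exists 1; split; first exact: num_real.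
  move=> M M1 s _ /=; rewrite ger0_norm ?kern_ge0//.
  by rewrite (le_trans (kern_le1 s))// ltW.
Qed.

Let mu_itv0 (x : R) : 0 <= x -> fine (mu `[0, x]) = x.
Proof.
rewrite le_eqVlt => /predU1P[<-|x0].
  by rewrite set_itv1 lebesgue_measure_set1.
by rewrite lebesgue_measure_itv/= lte_fin x0 oppr0 adde0.
Qed.

Lemma kern_int_ge0 x : 0 <= kern_int x.
Proof. by apply: Rintegral_ge0 => s _; exact: kern_ge0. Qed.

Lemma kern_int_le x : 0 <= x -> kern_int x <= x.
Proof.
move=> x0; rewrite -[leRHS]mu_itv0// -[leRHS]mul1r -Rintegral_cst//.
apply: le_Rintegral => //; first exact: kern_integrable.
  apply: measurable_bounded_integrable => //.
    exact: mu_itv_lty.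
  exact: bounded_cst.
by move=> s _; exact: kern_le1.
Qed.

Lemma kern_int1_gt0 : 0 < kern_int 1.
Proof.
apply: (@lt_le_trans _ _ 2^-1); first by rewrite invr_gt0.
rewrite -[leLHS]mulr1 -[X in _ * X](mu_itv0 ler01) -Rintegral_cst//.
apply: le_Rintegral => //; last 2 first.
- exact: kern_integrable.
- move=> s /=; rewrite in_itv/= => /andP[s0 s1].
  rewrite lef_pV2 ?posrE// -[leRHS]/(1 + 1) lerD2l.
  have : s `^ alpha^-1 <= 1 `^ alpha^-1.
    by apply: ge0_ler_powR; rewrite ?nnegrE ?invr_ge0// ltW.
  by rewrite powR1.
apply: measurable_bounded_integrable => //.
  exact: mu_itv_lty.
exact: bounded_cst.
Qed.

Lemma kern_int_nondecreasing : nondecreasing_fun kern_int.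
Proof.
move=> x y xy; rewrite /kern_int; apply: fine_le.
- apply: integrable_fin_num => //; exact: kern_integrable.
- apply: integrable_fin_num => //; exact: kern_integrable.
- apply: ge0_subset_integral => //.
  + by have /integrableP[] := kern_integrable y.
  + by move=> s _; rewrite lee_fin kern_ge0.
  + by move=> s /=; rewrite !in_itv/= => /andP[-> /le_trans]; apply.
Qed.

Lemma is_derive_kern_int (x : R) : 0 < x -> is_derive x 1 kern_int (kern x).
Proof.
move=> x0.
have dp := @is_derive1_powR R alpha^-1 x x0.
have dn : is_derive x 1 (fun s => 1 + s `^ alpha^-1) (0 + alpha^-1 * x `^ (alpha^-1 - 1)).
  exact: is_deriveD.
have ck : {for x, continuous kern}.
  apply/differentiable_continuous/derivable1_diffP.
  by have [] := @is_deriveV _ (fun s => 1 + s `^ alpha^-1) x _ 1 (lt0r_neq0 (den_gt0 x)) dn.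
have xx : x < x + 1 by rewrite ltrDl.
have [d1 d2] := continuous_FTC1_closed xx (kern_integrable (x + 1)) x0 ck.
by split; [exact: d1|rewrite -derive1E].
Qed.

(** Beyond 1 the kernel is below s ^ (- 1 / alpha), which has an explicit bounded
    primitive since alpha < 1: adding that primitive makes the integral
    nonincreasing. *)
Lemma kern_int_bounded : exists2 C, 0 <= C & forall x, kern_int x <= C.
Proof.
pose b := alpha^-1; have b1 : 1 < b by rewrite invf_gt1.
exists (1 + (b - 1)^-1) => [|x]; first by rewrite addr_ge0// invr_ge0; lra.
have [x1|x1] := leP x 1.
  rewrite (le_trans (kern_int_nondecreasing x1))//.
  by rewrite (le_trans (kern_int_le ler01))// lerDl invr_ge0; lra.
pose K t := kern_int t + (b - 1)^-1 * t `^ (1 - b).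
have dK (t : R) : 0 < t -> is_derive t 1 K (kern t - t `^ (- b)).
  move=> t0; have d1 := is_derive_kern_int t0.
  have d2 := @is_derive1_powR R (1 - b) t t0.
  apply: is_derive_eq; rewrite /GRing.scale /=.
  rewrite (_ : 1 - b - 1 = - b); last by ring.
  by field; rewrite subr_eq0 gt_eqF.
have : K x <= K 1.
  apply: (@ler0_derive1_le_oo R K 2^-1 (x + 1)).
  - by move=> t; rewrite in_itv/= => /andP[t0 _]; apply: ex_derive; apply: dK; lra.
  - move=> t; rewrite in_itv/= => /andP[t0 _].
    have t0' : 0 < t by lra.
    rewrite derive1E (@derive_val _ _ _ _ _ _ _ (dK t t0')) subr_le0 powRN /kern.
    rewrite lef_pV2 ?posrE// ?powR_gt0// -/b.
    by rewrite lerDr.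
  - move=> t; rewrite inE/= in_itv/= => /andP[t0 _].
    apply/differentiable_continuous/derivable1_diffP.
    by apply: ex_derive; apply: dK; lra.
  - by rewrite in_itv/=; apply/andP; split; lra.
  - by rewrite in_itv/=; apply/andP; split; lra.
  - exact: ltW.
rewrite /K powR1 mulr1; have := kern_int_le ler01.
have : 0 <= (b - 1)^-1 * x `^ (1 - b).
  by rewrite mulr_ge0 ?powR_ge0// invr_ge0; lra.
lra.
Qed.

Definition kern_lim : R := sup (range kern_int).

Lemma cvg_kern_int : kern_int x @[x --> +oo] --> kern_lim.
Proof.
apply: nondecreasing_cvgr; first exact: kern_int_nondecreasing.
by have [C _ hC] := kern_int_bounded; exists C => _ [x _ <-].
Qed.

Lemma kern_lim_gt0 : 0 < kern_lim.
Proof.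
apply: (lt_le_trans kern_int1_gt0); apply: ub_le_sup; last by exists 1.
by have [C _ hC] := kern_int_bounded; exists C => _ [x _ <-].
Qed.

(** The integral of t |-> lambda / (lambda + t ^ (1 / alpha)) over [0, M], rescaled
    so that its dependence on lambda is explicit. *)
Definition power_approx (lam M : R) : R :=
  lam `^ alpha * kern_int (M / lam `^ alpha).

Lemma power_approx_ge0 lam M : 0 <= power_approx lam M.
Proof. by rewrite mulr_ge0 ?powR_ge0// kern_int_ge0. Qed.

Lemma power_approx_le lam M : 0 <= lam -> 0 <= M -> power_approx lam M <= M.
Proof.
rewrite /power_approx le_eqVlt => /predU1P[<-|lam0] M0.
  by rewrite powR0 ?gt_eqF// mul0r.
have p0 : 0 < lam `^ alpha by rewrite powR_gt0.
rewrite mulrC -ler_pdivlMr//; apply: kern_int_le.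
by rewrite divr_ge0// ltW.
Qed.

Lemma is_derive_power_approx lam (M : R) : 0 <= lam -> 0 < M ->
  is_derive M 1 (power_approx lam) (lam / (lam + M `^ alpha^-1)).
Proof.
rewrite le_eqVlt => /predU1P[<-|lam0] M0.
  rewrite mul0r (_ : power_approx 0 = cst 0); first exact: is_derive_cst.
  by apply/funext => x; rewrite /power_approx powR0 ?gt_eqF// mul0r.
have p0 : 0 < lam `^ alpha by rewrite powR_gt0.
set p := lam `^ alpha in p0 *.
have Mp : 0 < M / p by rewrite divr_gt0.
have d1 := is_derive_kern_int Mp.
have d2 : is_derive M 1 (fun M => M / p) p^-1.
  by apply: is_derive_eq; rewrite /GRing.scale /=; ring.
have d3 := @is_derive1_comp R kern_int (fun M => M / p) M _ _ d1 d2.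
have [d4 d5] : is_derive M 1 (p \*: (kern_int \o (fun M => M / p)))
    (p *: (kern (M / p) * p^-1)) by exact: is_deriveZ.
have kE : kern (M / p) = lam / (lam + M `^ alpha^-1).
  have pb : p^-1 `^ alpha^-1 = lam^-1.
    rewrite -(powR_inv1 (ltW p0)) /p -!powRrM.
    rewrite (_ : alpha * (-1 / alpha) = -1); last by field; rewrite gt_eqF.
    by rewrite powR_inv1// ltW.
  rewrite /kern powRM ?invr_ge0 ?ltW// pb.
  have : 0 < lam + M `^ alpha^-1 by rewrite ltr_pwDl// powR_ge0.
  by move=> h; field; rewrite !gt_eqF//.
apply: DeriveDef; first exact: d4.
apply: (etrans d5); rewrite kE /GRing.scale /=.
by rewrite mulrCA mulfV ?mulr1// gt_eqF.
Qed.

Lemma cvg_power_approx lam : 0 <= lam ->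
  power_approx lam m.+1%:R @[m --> \oo] --> lam `^ alpha * kern_lim.
Proof.
rewrite le_eqVlt => /predU1P[<-|lam0].
  rewrite powR0 ?gt_eqF// mul0r /power_approx powR0 ?gt_eqF//.
  by under eq_fun do rewrite mul0r; exact: cvg_cst.
apply: cvgMr.
have p0 : 0 < lam `^ alpha by rewrite powR_gt0.
apply: (cvg_comp (fun m : nat => m.+1%:R / lam `^ alpha) kern_int _ cvg_kern_int).
apply/cvgryPge => A; near=> m; rewrite ler_pdivlMr//.
apply: (@le_trans _ _ m%:R); last by rewrite ler_nat.
by near: m; exact: nbhs_infty_ger.
Unshelve. all: by end_near. Qed.

(** Integrating the resolvent inequalities over t in [0, M] with mu = t ^ (1 /
    alpha) bounds the sum of power_approx (lam k) M * a k by e_ N * M.  A sum up to N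
    is compared with one up to N', at the cost of a tail of the absolutely
    convergent series, so that N' -> oo removes the error before M -> oo turns
    power_approx into a multiple of the power alpha. *)
Lemma subordination (lam a e_ : nat -> R) (B S : R) :
  (forall k, 0 <= lam k) -> e_ N @[N --> \oo] --> 0 ->
  (forall N m, 0 < m -> \sum_(k < N) lam k / (lam k + m) * a k <= e_ N) ->
  (forall N, \sum_(k < N) lam k `^ alpha * `|a k| <= B) ->
  \sum_(k < N) lam k `^ alpha * a k @[N --> \oo] --> S -> S <= 0.
Proof.
move=> lam0 ce hres hB cS.
pose A N M := \sum_(k < N) power_approx (lam k) M * a k.
pose T N := \sum_(k < N) lam k `^ alpha * `|a k|.
have [C C0 hC] := kern_int_bounded.
have AM N M : 0 < M -> A N M <= e_ N * M.
  move=> M0; pose Phi M := A N M - e_ N * M.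
  have dA (t : R) : 0 < t -> is_derive t 1 (A N)
      (\sum_(k < N) lam k / (lam k + t `^ alpha^-1) * a k).
    move=> t0; rewrite /A; elim: N {Phi} => [|N IH].
      by rewrite big_ord0; under eq_fun do rewrite big_ord0; exact: is_derive_cst.
    rewrite big_ord_recr/=; under eq_fun do rewrite big_ord_recr/=.
    apply: is_deriveD.
    have dp := is_derive_power_approx (lam0 N) t0.
    by apply: is_derive_eq; rewrite /GRing.scale /=; ring.
  have dPhi (t : R) : 0 < t -> is_derive t 1 Phi
      (\sum_(k < N) lam k / (lam k + t `^ alpha^-1) * a k - e_ N).
    move=> t0; have d1 := dA t t0.
    by apply: is_derive_eq; rewrite /GRing.scale /=; ring.
  have mono eps : 0 < eps -> eps < M -> Phi M <= Phi eps.
    move=> eps0 epsM; apply: (@ler0_derive1_le_oo R Phi 0 (M + 1)).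
    - by move=> t; rewrite in_itv/= => /andP[t0 _]; apply: ex_derive; exact: dPhi.
    - move=> t; rewrite in_itv/= => /andP[t0 _].
      rewrite derive1E (@derive_val _ _ _ _ _ _ _ (dPhi t t0)) subr_le0.
      by apply: hres; rewrite powR_gt0.
    - move=> t; rewrite inE/= in_itv/= => /andP[t0 _].
      apply/differentiable_continuous/derivable1_diffP.
      by apply: ex_derive; exact: dPhi.
    - by rewrite in_itv/=; apply/andP; split; lra.
    - by rewrite in_itv/=; apply/andP; split; lra.
    - exact: ltW.
  pose Q := \sum_(k < N) `|a k| + `|e_ N|.
  have Q0 : 0 <= Q by rewrite addr_ge0// sumr_ge0.
  have small eps : 0 < eps -> Phi eps <= eps * Q.
    move=> eps0; rewrite /Phi /Q mulrDr; apply: lerD.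
      rewrite mulr_sumr; apply: ler_sum => k _.
      rewrite (le_trans (ler_norm _))// normrM ler_wpM2r// ger0_norm ?power_approx_ge0//.
      by rewrite power_approx_le// ltW.
    rewrite -mulNr mulrC; apply: ler_wpM2l; first exact: ltW.
    by rewrite -normrN ler_norm.
  rewrite -subr_le0 -/(Phi M); apply/ler_addgt0Pr => d d0; rewrite add0r.
  pose eps := Num.min (M / 2) (d / (Q + 1)).
  have Q1 : 0 < Q + 1 by rewrite ltr_wpDl.
  have eps0 : 0 < eps by rewrite lt_min !divr_gt0.
  have epsM : eps < M.
    have : eps <= M / 2 by rewrite ge_min lexx.
    lra.
  have epsd : eps * Q <= d.
    have : eps <= d / (Q + 1) by rewrite ge_min lexx orbT.
    rewrite ler_pdivlMr//; nra.
  by rewrite (le_trans (mono _ eps0 epsM))// (le_trans (small _ eps0)).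
have ndT : nondecreasing_seq T.
  apply/nondecreasing_seqP => N; rewrite /T big_ord_recr/= lerDl.
  by rewrite mulr_ge0 ?powR_ge0.
have cT : cvgn T.
  by apply: nondecreasing_is_cvgn => //; exists B => _ [N _ <-]; exact: hB.
have tail N N' M : (N <= N')%N -> 0 < M ->
    A N M <= e_ N' * M + C * (T N' - T N).
  move=> NN' M0; apply: (@le_trans _ _ (A N' M + C * (T N' - T N))); last first.
    by rewrite lerD2r; exact: AM.
  elim: N' NN' => [|N' IH].
    by rewrite leqn0 => /eqP ->; rewrite subrr mulr0 addr0.
  rewrite leq_eqVlt => /predU1P[->|]; first by rewrite subrr mulr0 addr0.
  rewrite ltnS => /IH h; apply: (le_trans h).
  have -> : A N'.+1 M = A N' M + power_approx (lam N') M * a N'.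
    by rewrite /A big_ord_recr.
  have -> : T N'.+1 = T N' + lam N' `^ alpha * `|a N'|.
    by rewrite /T big_ord_recr.
  have : - (power_approx (lam N') M * a N') <= C * (lam N' `^ alpha * `|a N'|).
    rewrite (le_trans (ler_norm _))// normrN normrM mulrA; apply: ler_wpM2r => //.
    rewrite ger0_norm ?power_approx_ge0// mulrC.
    by apply: ler_wpM2l; rewrite ?powR_ge0.
  lra.
have tail2 N M : 0 < M -> A N M <= C * (limn T - T N).
  move=> M0.
  have h : e_ N' * M + C * (T N' - T N) @[N' --> \oo] --> 0 * M + C * (limn T - T N).
    apply: cvgD; first exact: cvgMl.
    by apply: cvgMr; apply: cvgB => //; exact: cvg_cst.
  rewrite mul0r add0r in h; apply: (cvgr_to_ge h).
  by near=> N'; apply: tail => //; near: N'; exact: nbhs_infty_ge.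
have tail3 N : kern_lim * (\sum_(k < N) lam k `^ alpha * a k) <= C * (limn T - T N).
  have h : A N m.+1%:R @[m --> \oo] -->
      \sum_(k < N) (lam k `^ alpha * kern_lim) * a k.
    apply: cvg_big => [|k _]; first exact: add_continuous.
    by apply: cvgMl; exact: cvg_power_approx.
  rewrite mulr_sumr (eq_bigr (fun k : 'I_N => (lam k `^ alpha * kern_lim) * a k)); last first.
    by move=> k _; ring.
  by apply: (cvgr_to_le h); near=> m; apply: tail2.
have : kern_lim * S <= C * (limn T - limn T).
  have c1 : C * (limn T - T N) @[N --> \oo] --> C * (limn T - limn T).
    by apply: cvgMr; apply: cvgB => //; exact: cvg_cst.
  have c2 : kern_lim * (\sum_(k < N) lam k `^ alpha * a k) @[N --> \oo] --> kern_lim * S.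
    exact: cvgMr.
  by apply: (ler_cvg_to c2 c1); near=> N; exact: tail3.
by rewrite subrr mulr0 pmulr_rle0// kern_lim_gt0.
Unshelve. all: by end_near. Qed.

End subordination.

(** * Weak maximum principle for the fractional Laplacian *)

Section fractional_trunc.
Variables (R : realType) (n : nat) (Om : set 'rV[R]_n).
Hypothesis (oOm : open Om) (bOm : bounded_set Om).
Variables (lam : nat -> R) (phi : nat -> 'rV[R]_n -> R) (alpha : R).
Hypothesis (eig : dirichlet_eigenbasis Om lam phi) (alpha01 : 0 < alpha < 1).

Let mOm : measurable Om := open_measurable_rV oOm.

(** The Beurling-Deny inequality for A (A + mu)^-1, for all mu, carries over to
    A ^ alpha by subordination; absolute convergence follows from the finite
    norm of v in H^{2 alpha} and Bessel's inequality for w. *)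
Lemma fracLap_trunc_le0 v f l : inH Om lam phi alpha v ->
  is_fracLap Om lam phi alpha v f -> l <= 0 ->
  dotL2 Om f (fun x => Num.max (l - v x) 0) <= 0.
Proof.
move=> [v2 voo] [f2 cf] l0; set w := fun x => Num.max (l - v x) 0.
have w2 : inL2 Om w by exact: inL2_trunc.
have b2 : inL2 Om (fun x => Num.max (v x) l) by exact: inL2_maxr.
pose s := combination phi (fun k => lam k `^ alpha * dotL2 Om v (phi k)).
have s2 N : inL2 Om (s N) by exact: (inL2_combination oOm eig).
have cs : dotL2 Om (s N) w @[N --> \oo] --> dotL2 Om f w.
  by apply: cvg_dot => //; apply: cvgL2_dot0.
have sE N : dotL2 Om (s N) w =
    \sum_(k < N) lam k `^ alpha * (dotL2 Om v (phi k) * dotL2 Om w (phi k)).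
  rewrite (dot_combination oOm eig)//; apply: eq_bigr => k _.
  by rewrite mulrA.
rewrite (funext sE) in cs.
pose e_ N := 2 * (Num.sqrt (expansion_error Om phi (fun x => Num.max (v x) l) N) *
    Num.sqrt (dotL2 Om w w)).
have ce : e_ N @[N --> \oo] --> 0.
  rewrite -[X in _ --> X](mulr0 2); apply: cvgMr.
  rewrite -[X in _ --> X](mul0r (Num.sqrt (dotL2 Om w w))); apply: cvgMl.
  rewrite -[X in _ --> X]sqrtr0.
  apply: (continuous_cvg _ (@sqrt_continuous R 0)).
  exact: (cvg_expansion oOm eig b2).
pose a k := dotL2 Om v (phi k) * dotL2 Om w (phi k).
have hres N m : 0 < m -> \sum_(k < N) lam k / (lam k + m) * a k <= e_ N.
  by move=> m0; exact: (yosida_pairing_le oOm bOm eig).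
suff hB N : \sum_(k < N) lam k `^ alpha * `|a k| <=
    fine (sqnormH Om lam phi alpha v) + dotL2 Om w w.
  exact: (subordination alpha01 (eigenvalue_ge0 eig) ce hres hB cs).
have h1 : \sum_(k < N) (lam k `^ alpha * dotL2 Om v (phi k)) ^+ 2 <=
    fine (sqnormH Om lam phi alpha v).
  have nn k : (0 <= (lam k `^ (2 * alpha) * dotL2 Om v (phi k) ^+ 2)%:E)%E.
    by rewrite lee_fin mulr_ge0 ?powR_ge0 ?sqr_ge0.
  rewrite -lee_fin fineK; last first.
    by rewrite ge0_fin_numE//; exact: nneseries_ge0.
  apply: (le_trans _ (nneseries_lim_ge N _)) => //.
  rewrite big_mkord -sumEFin; apply: lee_sum => k _.
  rewrite lee_fin exprMn mulrC [2 * alpha]mulrC powRrM powR_mulrn ?powR_ge0//.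
  by rewrite mulrC.
have h2 := bessel oOm eig N w2.
apply: (le_trans _ (lerD h1 h2)); rewrite -big_split/=.
apply: ler_sum => k _; rewrite /a normrM mulrA -{1}(ger0_norm (powR_ge0 (lam k) alpha)) -normrM.
set p := _ * dotL2 Om v _; set r := dotL2 Om w _.
rewrite -(real_normK (num_real p)) -(real_normK (num_real r)).
have := sqr_ge0 (`|p| - `|r|); have := sqr_ge0 (`|p| + `|r|); nra.
Qed.

End fractional_trunc.

(** * Topology of the space-time cylinder *)

Section topology.
Variable R : realType.

(** Without boundary points, Om would meet a line through one of its points in a
    nonempty open and closed set, hence contain the whole line. *)
Lemma bdry_nonempty n (Om : set 'rV[R]_n.+1) :
  open Om -> bounded_set Om -> Om !=set0 -> bdry Om !=set0.
Proof.
move=> oOm [M [_ hM]] [x Ox]; apply: contrapT => nbd.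
have clO : closed Om.
  move=> y yO; apply: contrapT => nOy; apply: nbd; exists y; split => //.
  by move=> /interior_subset.
pose f (s : R) : 'rV[R]_n.+1 := s *: ebasis R ord0 + x.
have cf : continuous f.
  move=> s A /nbhs_ballP[e /= e0 eA]; apply/nbhs_ballP; exists e => //= t st.
  apply: eA; apply/(rV_ballP _ _ e0) => i; rewrite !mxE.
  rewrite [X in `|X|](_ : _ = (s - t) * (i == ord0)%:R); last by ring.
  rewrite normrM; case: (i == ord0); first by rewrite normr1 mulr1.
  by rewrite normr0 mulr0.
have : connected [set: R] by apply/connected_intervalP.
move=> conn; have : f @^-1` Om = [set: R].
  apply: conn.
  - by exists 0; rewrite /f /= scale0r add0r.
  - exists (f @^-1` Om); last by rewrite setTI.
    by apply: open_comp => // s _; exact: cf.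
  - exists (f @^-1` Om); last by rewrite setTI.
    by apply: closed_comp => // s _; exact: cf.
move=> /seteqP[_ sub].
have /sub /= h : [set: R] (`|M| + 2 + `|x|) by [].
have := hM (`|M| + 1).
rewrite (le_lt_trans (ler_norm _)) ?ltrDl// => /(_ isT _ h) /=.
have := ler_normB (f (`|M| + 2 + `|x|)) x; rewrite /f addrK normrZ.
have -> : `|ebasis R (ord0 : 'I_n.+1)| = 1.
  apply/eqP; rewrite eq_le; apply/andP; split.
    rewrite /Num.norm /= mx_normrE; apply/bigmax_leP; split => // -[i j] _ /=.
    by rewrite /ebasis mxE; case: (_ && _); rewrite ?normr1 ?normr0.
  rewrite /Num.norm /= mx_normrE.
  apply: le_trans (le_bigmax _ _ (ord0, ord0)).
  by rewrite /ebasis /= mxE !eqxx normr1.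
rewrite mulr1 ger0_norm; last by rewrite !addr_ge0.
lra.
Qed.

Lemma compact_closure_bounded n (A : set 'rV[R]_n) :
  bounded_set A -> compact (closure A).
Proof.
move=> [M [Mr hM]]; apply: bounded_closed_compact; last exact: closed_closure.
exists M; split => // y My x Ax /=.
have cB : closed [set z : 'rV[R]_n | `|z| <= y].
  rewrite (_ : [set z : 'rV[R]_n | `|z| <= y] =
      (fun z : 'rV[R]_n => `|z|) @^-1` [set r | r <= y])//.
  apply: closed_comp; last exact: closed_le.
  by move=> z _; exact: norm_continuous.
by apply: cB; apply: closure_subset Ax => z Az; exact: hM Az.
Qed.

Lemma closure_prod (T U : topologicalType) (A : set T) (B : set U) x y :
  closure A x -> closure B y -> closure (A `*` B) (x, y).
Proof.
move=> Ax By C [[/= P Q] [xP yQ] PQ].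
have [a [Aa Pa]] := Ax _ xP; have [b [Bb Qb]] := By _ yQ.
by exists (a, b); split => //; apply: PQ.
Qed.

Lemma closure_itvoo (T t : R) : 0 < T -> 0 <= t <= T -> closure `]0, T[ t.
Proof.
move=> T0 /andP[t0 tT] B /nbhs_ballP[e /= e0 eB].
pose th := Num.min 2^-1 (e / T).
have th0 : 0 < th by rewrite lt_min invr_gt0 ltr0n divr_gt0.
have th1 : th <= 2^-1 by rewrite ge_min lexx.
have th2 : th * T <= e by rewrite -ler_pdivlMr// ge_min lexx orbT.
exists (t + th * (T / 2 - t)); split.
  by rewrite /= in_itv/=; apply/andP; split; nra.
apply: eB; rewrite /ball /= ltr_norml; apply/andP; split; nra.
Qed.

Lemma closure_cylinder n (Om : set 'rV[R]_n) (T : R) : 0 < T ->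
  closure (cylinder Om T) = closure Om `*` `[0, T].
Proof.
move=> T0; apply/seteqP; split => [z zc|[x t] /= [xO]].
  split.
    move=> B zB; have [|y [[Oy _] By]] := zc (fst @^-1` B); last by exists y.1.
    exact: cvg_fst.
  have cT : closed `[0, T]%classic by exact: interval_closed.
  apply: cT => B zB; have [|y [[_ Ty] By]] := zc (snd @^-1` B).
    exact: cvg_snd.
  exists y.2; split => //; move: Ty; rewrite /= !in_itv/=.
  by move=> /andP[/ltW -> ->].
rewrite in_itv/= => tT; apply: closure_prod => // B tB.
have [s [+ Bs]] := closure_itvoo T0 tT tB.
rewrite /= in_itv/= => /andP[s0 sT].
by exists s; split => //; rewrite /= in_itv/= s0 ltW.
Qed.

Lemma within_nbhs_Filter (X : topologicalType) (D : set X) (z : X) :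
  Filter (within D (nbhs z)).
Proof. exact: within_filter. Qed.

Lemma within_continuous_closure_ge0 (X : topologicalType) (D P : set X)
    (f : X -> R) z : {within D, continuous f} -> P `<=` D ->
  (forall y, P y -> 0 <= f y) -> D z -> closure P z -> 0 <= f z.
Proof.
move=> /subspace_continuousP cf PD fP Dz Pz; rewrite leNgt; apply/negP => fz.
have h := @cvgr_lt _ _ _ (within_nbhs_Filter D z) _ _ (cf z Dz) _ fz.
have [y [Py]] := Pz _ h.
by move=> /(_ (PD _ Py)); rewrite ltNge fP.
Qed.

Lemma within_continuous_section (X Y : topologicalType) (A : set X) (B : set Y)
    (f : X * Y -> R) t : {within A `*` B, continuous f} -> B t ->
  {within A, continuous (fun x => f (x, t))}.
Proof.
move=> /subspace_continuousP cf Bt; apply/subspace_continuousP => x Ax.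
have h := cf (x, t) (conj Ax Bt).
apply: cvg_comp h => C [[/= P Q] [xP tQ] PQ].
have tQt : Q t by exact: nbhs_singleton.
suff : nbhs x [set y | A y -> C (y, t)] by [].
by apply: filterS xP => y Py Ay; apply: PQ; split.
Qed.

Lemma open_lt_within (X : topologicalType) (A : set X) (f : X -> R) c :
  open A -> {within A, continuous f} -> open [set x | A x /\ f x < c].
Proof.
move=> oA /subspace_continuousP cf; rewrite openE => x [Ax fx].
have h := @cvgr_lt _ _ _ (within_nbhs_Filter A x) _ _ (cf x Ax) _ fx.
have hA : nbhs x A by exact: open_nbhs_nbhs.
have {}h : nbhs x [set y | A y -> f y < c] := h.
suff : nbhs x [set y | A y /\ f y < c] by [].
by apply: filterS2 h hA => y hy Ay; split; [|exact: hy].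
Qed.

End topology.

(** * The parabolic minimum principle *)

(** Only earlier times are used, since the difference quotient at t = T is one
    sided.  The limit of the quotient is at most L u (x, t); the constant 3 / 4
    allows a bound valid for all s within 1 / (4 L) of t. *)
Lemma dt_le_of_exp_min (R : realType) n (T L : R) (u : 'rV[R]_n * R -> R) x t :
  0 < L -> 0 < t -> t <= T -> u (x, t) < 0 ->
  cvg (time_quotient T u (x, t)) ->
  (forall s, 0 < s -> s < t ->
     expR (- L * t) * u (x, t) <= expR (- L * s) * u (x, s)) ->
  dt T u (x, t) <= 3 / 4 * L * u (x, t).
Proof.
move=> L0 t0 tT u0 cq hmin.
pose q s := (u (x, s) - u (x, t)) / (s - t).
have cq' : q s @[s --> t^'-] --> dt T u (x, t).
  apply: cvg_trans cq => A; rewrite /time_quotient /= => hA.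
  have {}hA : nbhs t [set s | s != t -> `]0, T]%classic s -> A (q s)] := hA.
  suff : nbhs t [set s | s < t -> A (q s)] by [].
  have t0' : nbhs t [set s | 0 < s] by exact: lt_nbhsr.
  apply: filterS2 hA t0' => s hs s0 st; apply: hs; first by rewrite lt_eqF.
  by rewrite /= in_itv/= s0 (le_trans (ltW st)).
apply: (cvgr_to_le cq'); near=> s.
have st : s < t by near: s; exact: nbhs_left_lt.
have s0 : 0 < s by near: s; exact: nbhs_left_gt.
have sL : t - (4 * L)^-1 < s.
  by near: s; apply: nbhs_left_gt; rewrite ltrBlDr ltrDl invr_gt0 mulr_gt0.
set c := u (x, t) in u0 *.
(* since u (x, t) < 0, the inequality 1 + y <= e^y may be applied with
   y = L (t - s) *)
have h1 : c <= (1 + L * (t - s)) * u (x, s).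
  have := hmin s s0 st; rewrite -/c => h.
  have {}h : c <= expR (L * (t - s)) * u (x, s).
    rewrite -(ler_pM2l (expR_gt0 (- L * t))) (le_trans h)// mulrA -expRD.
    by rewrite (_ : - L * t + L * (t - s) = - L * s)//; ring.
  have e1 : 1 + L * (t - s) <= expR (L * (t - s)) by exact: expR_ge1Dx.
  have p1 : 0 < 1 + L * (t - s) by rewrite ltr_pwDl// mulr_ge0// ?ltW// subr_gt0.
  have [us|us] := leP 0 (u (x, s)).
    by rewrite (le_trans (ltW u0))// mulr_ge0// ltW.
  by rewrite (le_trans h)// ler_wnM2r// ltW.
rewrite /q -/c ler_ndivrMr ?subr_lt0//.
have y1 : L * (t - s) < 4^-1.
  have : L * (t - s) < L * (4 * L)^-1 by rewrite ltr_pM2l//; lra.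
  by rewrite invfM mulrCA mulfV ?mulr1// gt_eqF.
have y0 : 0 < L * (t - s) by rewrite mulr_gt0// subr_gt0.
set y := L * (t - s) in h1 y1 y0 *.
rewrite (_ : 3 / 4 * L * c * (s - t) = - (3 / 4 * c * y)); last by rewrite /y; ring.
have : (1 + y) * (c - 3 / 4 * c * y) <= c.
  have : c * (y * (1 - 3 * y)) <= 0.
    by rewrite mulr_le0_ge0 ?ltW// mulr_gt0//; lra.
  rewrite -subr_ge0 => h; rewrite -subr_ge0.
  rewrite (_ : c - (1 + y) * (c - 3 / 4 * c * y) =
    4^-1 * (0 - c * (y * (1 - 3 * y)))); last by field.
  by rewrite mulr_ge0.
move=> /le_trans /(_ h1); rewrite ler_pM2l; lra.
Unshelve. all: by end_near. Qed.

Lemma integral_gt0_open (R : realType) n (Om : set 'rV[R]_n) (w : 'rV[R]_n -> R)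
    x0 : open Om -> (leb R n).-integrable Om (EFin \o w) ->
  (forall x, Om x -> 0 <= w x) -> {within Om, continuous w} -> Om x0 -> 0 < w x0 ->
  0 < \int[leb R n]_(x in Om) w x.
Proof.
move=> oOm iw w0 /subspace_continuousP cw Ox0 wx0.
have mOm := open_measurable_rV oOm.
have [e e0 eB] : exists2 e : R, 0 < e & forall x, ball x0 e x -> Om x /\ w x0 / 2 < w x.
  have h2 : w x0 / 2 < w x0 by lra.
  have h := @cvgr_gt _ _ _ (within_nbhs_Filter Om x0) _ _ (cw x0 Ox0) _ h2.
  have {}h : nbhs x0 [set x | Om x -> w x0 / 2 < w x] := h.
  have hO : nbhs x0 Om by exact: open_nbhs_nbhs.
  have : nbhs x0 [set x | Om x /\ w x0 / 2 < w x].
    by apply: filterS2 h hO => y hy Ay; split; [|exact: hy].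
  by move=> /nbhs_ballP[e /= e0 eB]; exists e.
have mB : measurable (ball x0 e) by exact: measurable_rV_ball.
have BO : ball x0 e `<=` Om by move=> x /eB[].
have mw : measurable_fun Om (EFin \o w) by have /integrableP[] := iw.
rewrite -lte_fin fineK; last exact: integrable_fin_num.
apply: (@lt_le_trans _ _ (\int[leb R n]_(x in ball x0 e) (w x0 / 2)%:E)%E).
  rewrite integral_cst// mule_gt0 ?lte_fin ?divr_gt0//.
  exact: leb_ball_gt0.
apply: (@le_trans _ _ (\int[leb R n]_(x in ball x0 e) (w x)%:E)%E).
  apply: ge0_le_integral => //.
  - by move=> x _; rewrite lee_fin divr_ge0// ltW.
  - exact: measurable_funS mw.
  - by move=> x /eB[_ h]; rewrite lee_fin ltW.
by apply: ge0_subset_integral => // x /w0; rewrite lee_fin.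
Qed.

Lemma dot_ae_ge (R : realType) n (Om : set 'rV[R]_n) (f w : 'rV[R]_n -> R) (d : R) :
  measurable Om -> inL2 Om f -> inL2 Om w -> (leb R n).-integrable Om (EFin \o w) ->
  {ae leb R n, forall x, Om x -> d * w x <= f x * w x} ->
  d * \int[leb R n]_(x in Om) w x <= dotL2 Om f w.
Proof.
move=> mOm f2 w2 iw ae.
have ifw := inL2_integrableM mOm f2 w2.
have idw : (leb R n).-integrable Om (EFin \o (fun x => d * w x)).
  exact: (integrableZl mOm d iw).
rewrite -RintegralZl// -subr_ge0 /dotL2 -RintegralB//.
pose h x := f x * w x - d * w x.
have mh : measurable_fun Om (EFin \o h).
  have := integrableB mOm ifw idw; by move=> /integrableP[].
rewrite /Rintegral (@ae_eq_integral _ _ _ (leb R n) Om (fun x => `|(h x)%:E|%E))//.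
- by apply: fine_ge0; exact: integral_ge0.
- exact: measurableT_comp.
- apply: filterS ae => x hx Ox; rewrite /= ger0_norm// subr_ge0; exact: hx.
Qed.
Theorem corollary4p4p1 (R : realType) (n : nat) (Om : set 'rV[R]_n.+1)
    (alpha T g : R)
    (lam : nat -> R) (phi : nat -> 'rV[R]_n.+1 -> R)
    (k : 'rV[R]_n.+1 * R -> R) (k0 : R)
    (u : 'rV[R]_n.+1 * R -> R) (c : R -> R) (c0 : R) :
  bounded_lipschitz_domain Om ->
  0 < alpha < 1 ->
  0 < T ->
  dirichlet_eigenbasis Om lam phi ->
  {within cylinder Om T, continuous k} ->
  (exists M : R, forall z, cylinder Om T z -> `|k z| <= M) ->
  0 < k0 ->
  (forall z, cylinder Om T z -> k0 <= k z) ->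
  C11 Om T u ->
  {within closure (cylinder Om T), continuous u} ->
  (forall (x : 'rV[R]_n.+1) (t : R), bdry Om x -> t \in `]0, T[ -> u (x, t) = g) ->
  continuous_inH Om lam phi alpha T (fun z => u z - g) ->
  0 < c0 ->
  (forall r : R, - c0 <= c r) ->
  (forall t, t \in `]0, T] ->
    exists2 f : 'rV[R]_n.+1 -> R,
      is_fracLap_bc Om lam phi alpha g (fun x => u (x, t)) f &
      {ae leb R n.+1, forall x, Om x ->
        0 <= k (x, t) * dt T u (x, t) + f x + c (u (x, t)) * u (x, t)}) ->
  (forall z, parabolic_boundary Om T z -> 0 <= u z) ->
  forall z, closure (cylinder Om T) z -> 0 <= u z.
Proof.
move=> [oOm _ Om0 bOm _] alpha01 T0 eig _ _ k0_gt0 kk0 [_ _ cvg_dt cdt] cu.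
move=> ubdry Hu c0_gt0 cc0 ineq upar.
have cl := closure_cylinder Om T0.
set D := closure (cylinder Om T).
have intOm : interior Om = Om by exact/interior_id.
have bdryE x : closure Om x -> ~ Om x -> bdry Om x by move=> ? ?; split; rewrite ?intOm.
have bcl x : bdry Om x -> closure Om x by case.
have T2 : T / 2 \in `]0, T[ by rewrite in_itv/=; apply/andP; split; lra.
have g0 : 0 <= g.
  have [x bx] := bdry_nonempty oOm bOm Om0.
  by rewrite -(ubdry x (T / 2) bx T2); apply: upar; left.
have parD : parabolic_boundary Om T `<=` D.
  rewrite /D cl => -[x t] [[/= bx]|[/= Ox ->]].
    rewrite /= in_itv/= => /andP[t0 tT]; split => /=; first exact: bcl.
    by rewrite in_itv/= !ltW.
  by split; [exact: subset_closure|rewrite /= in_itv/= lexx ltW].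
(* by continuity the sign on the parabolic boundary extends to the closure of
   the lateral boundary, which contains the corners t = 0 and t = T *)
have ubd x t : bdry Om x -> 0 <= t <= T -> 0 <= u (x, t).
  move=> bx tT; apply: (within_continuous_closure_ge0 cu parD upar).
    by rewrite cl; split; [exact: bcl|rewrite /= in_itv].
  move=> B /(closure_prod (@subset_closure _ (bdry Om) x bx) (closure_itvoo T0 tT)).
  by move=> [y [yP By]]; exists y; split => //; left.
have cD : compact D.
  apply: (@subclosed_compact _ _ (closure Om `*` `[0, T]%classic)).
  - exact: closed_closure.
  - apply: compact_setX; last exact: segment_compact.
    exact: compact_closure_bounded.
  - by rewrite /D cl.
pose L := 4 * c0 / k0.
have L0 : 0 < L by rewrite divr_gt0// mulr_gt0.
pose U (z : 'rV[R]_n.+1 * R) := expR (- L * z.2) * u z.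
have cU : {within D, continuous U}.
  apply/subspace_continuousP => z Dz; apply: cvgM; last first.
    by move/subspace_continuousP : cu => /(_ z Dz).
  apply: cvg_within_filter.
  apply: (continuous_comp (f := fun z : 'rV[R]_n.+1 * R => - L * z.2) (g := expR)).
    by apply: cvgMr; exact: cvg_snd.
  exact: continuous_expR.
move=> z Dz; rewrite leNgt; apply/negP => uz0.
have [z0 Dz0 minU] : exists2 z0, D z0 & forall y, D y -> U z0 <= U y.
  have [z0 z0D h] := compact_EVT_min (ex_intro _ z Dz) cD cU.
  exists z0; first exact: set_mem.
  by move=> y Dy; apply: h; exact: mem_set.
have Uz0 : U z0 < 0.
  by apply: le_lt_trans (minU z Dz) _; rewrite pmulr_rlt0// expR_gt0.
case: z0 Dz0 minU Uz0 => x0 t0 Dz0 minU Uz0.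
have [x0cl] : (closure Om `*` `[0, T]%classic) (x0, t0) by rewrite -cl.
rewrite /= in_itv/= => t0T; have /andP[t0_ge0 t0_leT] := t0T.
have neg x t : U (x, t) < 0 -> u (x, t) < 0.
  by rewrite /U /= pmulr_rlt0// expR_gt0.
have Ox0 : Om x0.
  apply: contrapT => nO; have := ubd x0 t0 (bdryE _ x0cl nO) t0T.
  by rewrite leNgt neg.
have t0_gt0 : 0 < t0.
  rewrite lt_neqAle t0_ge0 andbT; apply/eqP => t00.
  have := neg _ _ Uz0; rewrite ltNge => /negP; apply; apply: upar; right.
  by split => //=.
have t0in : t0 \in `]0, T] by rewrite in_itv/= t0_gt0.
set m := u (x0, t0).
have m0 : m < 0 by exact: neg.
have Dt0 x : closure Om x -> D (x, t0) by rewrite /D cl => ?; split.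
have cyl x : Om x -> cylinder Om T (x, t0) by move=> ?; split.
have minu x : closure Om x -> m <= u (x, t0).
  by move=> /Dt0 /minU; rewrite /U /= ler_pM2l// expR_gt0.
have dtmin x : Om x -> u (x, t0) = m -> dt T u (x, t0) <= 3 / 4 * L * m.
  move=> Ox uxm; rewrite -uxm; apply: dt_le_of_exp_min => //.
  - by rewrite uxm.
  - by apply: cvg_dt; exact: cyl.
  - move=> s s0 st; rewrite uxm; apply: (minU (x, s)).
    rewrite /D cl; split; first exact: subset_closure.
    by rewrite /= in_itv/= ltW//= (le_trans (ltW st)).
pose V := [set x | Om x /\ dt T u (x, t0) < 2^-1 * L * m].
have oV : open V.
  apply: open_lt_within => //.
  exact: (within_continuous_section cdt t0in).
have cus : {within closure Om, continuous (fun x => u (x, t0))}.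
  apply: (within_continuous_section (B := `[0, T]%classic)).
    by rewrite -cl; exact: cu.
  by rewrite /= in_itv.
(* below the level lev, dt u is bounded away from 0 *)
have [lev [mlev lev0 levV]] : exists lev, [/\ m < lev, lev < 0 &
    forall x, Om x -> u (x, t0) < lev -> V x].
  pose C := closure Om `&` ~` V.
  have cC : compact C.
    apply: (@subclosed_compact _ _ (closure Om)).
    - by apply: closedI; [exact: closed_closure|exact: open_closedC].
    - exact: compact_closure_bounded.
    - by move=> x [].
  have [C0|/set0P C0] := eqVneq C set0.
    exists (m / 2); split; [lra|lra|] => x Ox _; apply: contrapT => nV.
    have : C x by split => //; exact: subset_closure.
    by rewrite C0.
  have cuC : {within C, continuous (fun x => u (x, t0))}.
    by apply: continuous_subspaceW cus => x [].
  have [x1 /set_mem[x1cl nVx1] hx1] := compact_EVT_min C0 cC cuC.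
  have mx1 : m < u (x1, t0).
    rewrite lt_neqAle minu// andbT; apply/eqP => mE; apply: nVx1.
    have Ox1 : Om x1.
      apply: contrapT => nO; have := ubd x1 t0 (bdryE _ x1cl nO) t0T.
      by rewrite -mE leNgt m0.
    split => //; have := dtmin x1 Ox1 (esym mE).
    have : L * m < 0 by rewrite pmulr_rlt0.
    nra.
  exists (Num.min ((m + u (x1, t0)) / 2) (m / 2)); split.
  - by rewrite lt_min; apply/andP; split; lra.
  - by rewrite gt_min; apply/orP; right; lra.
  - move=> x Ox; rewrite lt_min => /andP[ux _]; apply: contrapT => nV.
    have : C x by split => //; exact: subset_closure.
    by move=> /mem_set /hx1; lra.
have [f [f2 cf] aef] := ineq t0 t0in.
have t0in' : t0 \in `[0, T] by rewrite in_itv/= t0_ge0.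
have [Hv _] := Hu t0 t0in'.
have v2 : inL2 Om (fun x => u (x, t0) - g) by case: Hv.
pose l := lev - g.
have l0 : l <= 0 by rewrite /l; lra.
pose w x := Num.max (l - (u (x, t0) - g)) 0.
have mOm := open_measurable_rV oOm.
have w2 : inL2 Om w by exact: (inL2_trunc oOm v2 l0).
have wE x : w x = Num.max (lev - u (x, t0)) 0.
  by rewrite /w /l; congr (Num.max _ _); ring.
have iw : (leb R n.+1).-integrable Om (EFin \o w).
  have c2 : inL2 Om (fun _ => 1).
    split => //; rewrite integral_cst//= expr1n mul1e.
    exact: leb_bounded_lty.
  have := inL2_integrableM mOm w2 c2.
  by apply: eq_integrable => // x _ /=; rewrite mulr1.
have le0 := fracLap_trunc_le0 oOm bOm eig alpha01 Hv (conj f2 cf) l0.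
have w_gt0 : 0 < \int[leb R n.+1]_(x in Om) w x.
  apply: (@integral_gt0_open _ _ _ _ x0) => //.
  - by move=> x _; rewrite /w le_max lexx orbT.
  - have cusO : {within Om, continuous (fun x => u (x, t0))}.
      by apply: continuous_subspaceW cus; exact: subset_closure.
    apply/subspace_continuousP => x Ox.
    rewrite /from_subspace (funext wE).
    have cm : continuous (fun r : R => Num.max (lev - r) 0).
      move=> r; have cl' : {for r, continuous (fun r : R => lev - r)}.
        by apply: cvgB; [exact: cvg_cst|exact: cvg_id].
      exact: (continuous_max cl' (@cst_continuous _ _ (0 : R) r)).
    have /subspace_continuousP/(_ x Ox) h := cusO.
    exact: cvg_comp h (cm (u (x, t0))).
  - by rewrite wE lt_max subr_gt0 mlev.
have : - m * c0 * \int[leb R n.+1]_(x in Om) w x <= dotL2 Om f w.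
  apply: dot_ae_ge => //; apply: filterS aef => x hx Ox.
  rewrite wE; have [_|ulev] := leP (lev - u (x, t0)) 0; first by rewrite !mulr0.
  apply: ler_wpM2r; first exact: ltW.
  rewrite subr_gt0 in ulev.
  have [_ dtx] := levV x Ox ulev.
  have kx := kk0 _ (cyl x Ox).
  have ux0 : u (x, t0) < 0 by lra.
  have mux := minu x (subset_closure Ox).
  have cx := cc0 (u (x, t0)).
  have h1 : k (x, t0) * dt T u (x, t0) <= k0 * (2^-1 * L * m).
    have : 2^-1 * L * m < 0 by nra.
    nra.
  have h2 : c (u (x, t0)) * u (x, t0) <= - c0 * m by nra.
  have h3 : k0 * (2^-1 * L * m) = 2 * c0 * m.
    by rewrite /L; field; rewrite gt_eqF.
  have := hx Ox; lra.
apply/negP; rewrite -ltNge; apply: le_lt_trans le0 _.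
by rewrite !mulr_gt0// oppr_gt0.
Qed.
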